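(* Let $p\in(0,1]$, $h=p/(1+p)$, $\lambda>0$, and let $0<\rho<h$ be fixed. Consider, for each $n$, the TASEP-H process with A-perturbations on $n$ sites with $\rho n$ particles and parameter $\lambda$, and its scaled state descriptors $[f^n(\cdot,t),\ell^n(t),r^n(t),\tau^n(t)]$. Then, as $n\to\infty$, any subsequential weak limit of the sequence of stationary distributions of $[f^n(\cdot,t),\ell^n(t),r^n(t),\tau^n(t)]$ is concentrated on states with $\tau=0$. In other words, $\tau^n(\infty)\Rightarrow 0$ in distribution (equivalently, $\mathbb{E}\,\tau^n(\infty)\to 0$), where $\tau^n(\infty)$ denotes $\tau^n$ in the stationary regime. Consequently, the limiting flux (typical flux) is $\phi(\rho)=\lim_{n\to\infty}\phi(\rho,n)=\rho$.
   Context: Basic dynamics (TASEP-H). There are $n$ sites $0,1,\dots,n-1$ arranged in a circle (clockwise = ''right'') and a constant number $\rho n$ of particles (assumed an integer; otherwise use $\lceil\rho n\rceil$), at most one per site; empty sites are called holes. Time is discrete, $t=0,1,2,\dots$. Given the state at time $t$, the state at $t+1$ is obtained by applying to each particle simultaneously and independently: (a) if its right-neighbor site is occupied, it does not move; (b) if both neighbor sites are holes, it moves one site right with probability $1$; (c) if the right-neighbor site is a hole and the left-neighbor site is occupied, it moves one site right with probability $p$. A particle is free if both neighbor sites are holes. A cluster is a maximal contiguous set of at least two particles. A state is ideal if it contains no clusters. Perturbation. A perturbation of a state: a particle chosen uniformly at random is removed (its site immediately becoming a hole), and is then placed into one of the holes chosen uniformly at random (possibly the same site). A-perturbations model with parameter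 $\lambda>0$: at each time $t$ such that the state after the normal particle movement at time $t$ is ideal, one perturbation is applied with probability $\lambda/n$, independently of the past; it takes no extra time, and the state at time $t$ is the state after movement and after the perturbation, if any. The state space is restricted to states reachable from a state in which all particles are in one cluster; on it the chain is irreducible, and every state has at most one cluster. Flux. For a state $\overline Z$, $\phi(\rho,n;\overline Z)=\psi(\rho,n;\overline Z)/n$, where $\psi(\rho,n;\overline Z)$ is the expected total distance traveled by all particles in the next time step when the current state is $\overline Z$ (a particle relocated by a perturbation is considered to travel clockwise to its new site). The flux is $\phi(\rho,n)=\mathbb{E}\,\phi(\rho,n;\overline Z(\infty))$ with $\overline Z(\infty)$ distributed according to the stationary distribution. The limiting (typical) flux is $\phi(\rho)=\lim_{n\to\infty}\phi(\rho,n)$, with $\rho,\lambda,p$ fixed. Scaled state. Space, time and particle numbers are divided by $n$; scaled time $t$ corresponds to unscaled time $\lfloor nt\rfloor$. Only increments of $f^n(\cdot,t)$ matter; in the standard version, $f^n(x,t)$ for $x\in[0,1)$ is $1/n$ times the number of particles in sites $1,\dots,\lfloor nx\rfloor$ (so $f^n(0,t)=0$), extended to $x\in\mathbb{R}$ by $f^n(x+1,t)=f^n(x,t)+\rho$. If a cluster exists at time $t$, $\ell^n(t)$ and $r^n(t)$ are the scaled locations (site number divided by $n$) of its leftmost and rightmost particles, with (standard version) $\ell^n(t)\in[0,1)$ and $r^n(t)\ge\ell^n(t)$ measured clockwise from $\ell^n(t)$, and $\tau^n(t)=r^n(t)-\ell^n(t)$ (so the cluster has $n\tau^n(t)+1$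 particles). If no cluster exists, $\tau^n(t)=0$ and $\ell^n(t)=r^n(t)$ is frozen at the value of $\ell^n$ at the last time a cluster existed (or $0$ if none existed before). The metric on states is the sum of: the sup-norm distance for $f$; $|\tau_1-\tau_2|$ for $\tau$; and the unit-circle distance $\min_{k\in\mathbb{Z}}|\ell_1-\ell_2+k|$ for $\ell$, and similarly for $r$. *)

(* Defs.v *)
From HB Require Import structures.
From mathcomp Require Import all_boot all_order all_algebra.
From mathcomp Require Import all_classical all_reals all_analysis.
From mathcomp Require Import ring lra.

Set Implicit Arguments.
Unset Strict Implicit.
Unset Printing Implicit Defensive.

Import Order.TTheory GRing.Theory Num.Theory.
Import numFieldNormedType.Exports.

Local Open Scope classical_set_scope.
Local Open Scope ring_scope.

(* The sites 'I_n lie on a circle, oriented by ordS (i -> i + 1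
   mod n; "clockwise", "right").  A configuration is the set of occupied
   sites. *)

Section Configurations.
Variable n : nat.
Implicit Types (A C D : {set 'I_n}) (a i x y : 'I_n).

Definition cw_dist x y : nat := ((y + n - x) %% n)%N.

(* The sites a, a + 1, ..., a + k - 1. *)
Definition arc a (k : nat) : {set 'I_n} :=
  [set iter (j : 'I_k) (@ordS n) a | j : 'I_k]%SET.

Definition contiguous C : bool := [exists a : 'I_n, C == arc a #|C|].

Definition cluster A C : bool :=
  (2 <= #|C|)%N && maxset (fun D => contiguous D && (D \subset A)) C.

Definition ideal A : bool := [forall C : {set 'I_n}, ~~ cluster A C].

(* On the restricted state space there is at most one cluster, so that the
   choice made by [pick] is immaterial; set0 stands for "no cluster". *)
Definition the_cluster A : {set 'I_n} :=
  odflt finset.set0 [pick C | cluster A C].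

Definition leftmost A : option 'I_n :=
  if ideal A then None else [pick a | the_cluster A == arc a #|the_cluster A|].

End Configurations.

Definition num_particles (R : realType) (rho : R) (n : nat) : nat :=
  `|Num.ceil (rho * n%:R)|%N.

Section Dynamics.
Variables (R : realType) (n : nat) (p lambda : R).
Implicit Types (A B C M : {set 'I_n}).

(* Meant for i in A; the three cases are blocked, held back and free. *)
Definition move_prob A (i : 'I_n) : R :=
  if ordS i \in A then 0 else if ord_pred i \in A then p else 1.

(* Probability that M is exactly the set of particles of A that move. *)
Definition move_weight A M : R :=
  \prod_(i in A) (if i \in M then move_prob A i else 1 - move_prob A i).

Definition move A M : {set 'I_n} := (A :\: M) :|: [set ordS i | i in M]%SET.

(* In the two functions below, g takes the new configuration and the distance
   travelled, and the result is the expectation of g. *)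
Definition perturb_mean C (g : {set 'I_n} -> nat -> R) : R :=
  (\sum_(x in C)
     (\sum_(y in ~: (C :\ x)) g (y |: (C :\ x)) (cw_dist x y))
       / #|~: (C :\ x)|%:R)
  / #|C|%:R.

Definition step_mean A (g : {set 'I_n} -> nat -> R) : R :=
  \sum_(M : {set 'I_n} | M \subset A) move_weight A M *
    (let C := move A M in
     if ideal C then
       (1 - lambda / n%:R) * g C #|M| +
       lambda / n%:R * perturb_mean C (fun B d => g B (#|M| + d)%N)
     else g C #|M|).

Definition kernel A B : R := step_mean A (fun B' _ => (B' == B)%:R).

Definition psi A : R := step_mean A (fun _ d => d%:R).

Definition flux_at A : R := psi A / n%:R.

(* cluster A A: all the particles of A form one cluster. *)
Definition admissible (k : nat) B : bool :=
  [exists A : {set 'I_n}, [&& #|A| == k, cluster A A &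
     connect (fun A' B' => 0 < kernel A' B') A B]].

End Dynamics.

(* Since the location of the cluster is frozen when the
   cluster disappears, the descriptors are not functions of the configuration
   alone: a state also records the leftmost site of the current or last
   cluster (None if there has been no cluster). *)

Definition chain_state (n : nat) := ({set 'I_n} * option 'I_n)%type.

Section Chain.
Variables (R : realType) (n : nat) (p lambda : R).
Implicit Types (A B : {set 'I_n}) (s t : chain_state n).

Definition last_left A (m : option 'I_n) : option 'I_n :=
  if leftmost A is Some a then Some a else m.

Definition trans s t : R :=
  kernel p lambda s.1 t.1 * (t.2 == last_left t.1 s.2)%:R.

Definition stationary (k : nat) (P : chain_state n -> R) : Prop :=
  [/\ forall s, 0 <= P s,
      \sum_s P s = 1,
      forall s, ~~ admissible p lambda k s.1 -> P s = 0
    & forall t, P t = \sum_s P s * trans s t].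

Definition mean (P g : chain_state n -> R) : R := \sum_s P s * g s.

Definition flux (P : chain_state n -> R) : R :=
  mean P (fun s => flux_at p lambda s.1).

End Chain.

(* The fourth descriptor is tau = r - l.  Here l ranges over [0, 1[ and r >= l
   is its unrolled counterpart, as in the standard version of the state. *)

Record scaled_state (R : realType) := ScaledState {
  ss_f : R -> R ;
  ss_l : R ;
  ss_r : R ;
  ss_f0 : ss_f 0 = 0 ;
  ss_f_homo : {homo ss_f : x y / x <= y} ;
  ss_f_per : forall x, ss_f (x + 1) = ss_f x + ss_f 1 ;
  ss_l_itv : 0 <= ss_l < 1 ;
  ss_l_le_r : ss_l <= ss_r }.

Definition ss_tau (R : realType) (s : scaled_state R) : R := ss_r s - ss_l s.

Definition circle_dist (R : realType) (x y : R) : R :=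
  inf [set `|x - y + k%:~R| | k in [set: int]].

(* f - f' is 1-periodic when f and f' have the same increment over a period,
   so that this is then also the supremum over the whole line. *)
Definition sup_dist (R : realType) (f f' : R -> R) : R :=
  sup [set `|f x - f' x| | x in `[0, 1]].

Definition ss_dist (R : realType) (s t : scaled_state R) : R :=
  sup_dist (ss_f s) (ss_f t) + `|ss_tau s - ss_tau t| +
  circle_dist (ss_l s) (ss_l t) + circle_dist (ss_r s) (ss_r t).

Section CircleDist.
Variable R : realType.
Implicit Types x y z : R.

Let has_inf_circle x y : has_inf [set `|x - y + k%:~R| | k in [set: int]].
Proof.
by split; [exists `|x - y + 0%:~R|; exists 0 | exists 0 => _ [k _ <-]].
Qed.

Lemma circle_dist_ge0 x y : 0 <= circle_dist x y.
Proof.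
by apply: lb_le_inf => [|_ [k _ <-]//]; exact: (has_inf_circle x y).1.
Qed.

Lemma circle_dist_le x y (k : int) : circle_dist x y <= `|x - y + k%:~R|.
Proof. by apply: ge_inf; [exact: (has_inf_circle x y).2 | exists k]. Qed.

Lemma circle_distxx x : circle_dist x x = 0.
Proof.
apply/eqP; rewrite eq_le circle_dist_ge0 andbT.
by have := circle_dist_le x x 0; rewrite subrr addr0 normr0.
Qed.

Lemma circle_dist_sym x y : circle_dist x y = circle_dist y x.
Proof.
congr inf; apply/seteqP; split => _ [k _ <-] /=; exists (- k) => //.
  by rewrite -normrN; congr `|_|; rewrite mulrNz; ring.
by rewrite -normrN; congr `|_|; rewrite mulrNz; ring.
Qed.

Lemma circle_dist_triangle y x z :
  circle_dist x z <= circle_dist x y + circle_dist y z.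
Proof.
apply/ler_addgt0Pr => e e0; have e2 : 0 < e / 2 by rewrite divr_gt0.
have [_ [k _ <-] hk] := inf_adherent e2 (has_inf_circle x y).
have [_ [l _ <-] hl] := inf_adherent e2 (has_inf_circle y z).
apply: le_trans (circle_dist_le x z (k + l)) _.
rewrite -/(circle_dist x y) in hk; rewrite -/(circle_dist y z) in hl.
have -> : x - z + (k + l)%:~R = (x - y + k%:~R) + (y - z + l%:~R).
  by rewrite intrD; ring.
by apply: le_trans (ler_normD _ _) _; lra.
Qed.

Lemma circle_dist_eq0 x y :
  0 <= x < 1 -> 0 <= y < 1 -> circle_dist x y = 0 -> x = y.
Proof.
move=> /andP[x0 x1] /andP[y0 y1] d0; apply/eqP; rewrite -subr_eq0.
apply/negPn/negP => xy0; pose c := Num.min `|x - y| (1 - `|x - y|).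
have lt1 : `|x - y| < 1 by rewrite ltr_norml; apply/andP; split; lra.
have c0 : 0 < c by rewrite lt_min normr_gt0 xy0 subr_gt0.
suff : c <= circle_dist x y by rewrite d0 leNgt c0.
apply: lb_le_inf => [|_ [k _ <-]]; first exact: (has_inf_circle x y).1.
have [->|k0] := eqVneq k 0; first by rewrite addr0 ge_min lexx.
rewrite ge_min; apply/orP; right.
have k1 : 1 <= `|k%:~R : R| by rewrite -intr_norm ler1z -gtz0_ge1 normr_gt0.
have := lerB_normD (k%:~R : R) (x - y); rewrite (addrC k%:~R) => h.
by apply: le_trans h; rewrite lerB.
Qed.

End CircleDist.

Section ScaledStateMetric.
Variable R : realType.
Implicit Types s t u : scaled_state R.

Let has_sup_dist s t : has_sup [set `|ss_f s x - ss_f t x| | x in `[0, 1]].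
Proof.
split.
  by exists `|ss_f s 0 - ss_f t 0|; exists 0; rewrite //= in_itv/= lexx ler01.
exists (ss_f s 1 + ss_f t 1) => y [x /=]; rewrite in_itv/= => /andP[x0 x1] <-.
have := ss_f_homo s x0; have := ss_f_homo s x1.
have := ss_f_homo t x0; have := ss_f_homo t x1.
by rewrite !ss_f0 ler_norml => *; apply/andP; split; lra.
Qed.

Let sup_dist_ge s t x : 0 <= x <= 1 ->
  `|ss_f s x - ss_f t x| <= sup_dist (ss_f s) (ss_f t).
Proof.
move=> x01; apply: ub_le_sup; first exact: (has_sup_dist s t).2.
by exists x.
Qed.

Let sup_dist_ge0 s t : 0 <= sup_dist (ss_f s) (ss_f t).
Proof. by apply: le_trans (@sup_dist_ge s t 0 _); rewrite ?lexx ?ler01. Qed.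

Let dist_xx s : ss_dist s s = 0.
Proof.
rewrite /ss_dist !circle_distxx subrr normr0 !addr0.
apply/eqP; rewrite eq_le sup_dist_ge0 andbT.
apply: ge_sup => [|_ [x _ <-]]; first exact: (has_sup_dist s s).1.
by rewrite subrr normr0.
Qed.

Lemma scaled_state_eq s t :
  ss_f s = ss_f t -> ss_l s = ss_l t -> ss_r s = ss_r t -> s = t.
Proof.
case: s t => [f l r a b c d e] [f' l' r' a' b' c' d' e'] /= E1 E2 E3.
by subst; f_equal; exact: Prop_irrelevance.
Qed.

Let per_floor s x :
  ss_f s x = ss_f s (x - (Num.floor x)%:~R) + ss_f s 1 *~ Num.floor x.
Proof.
have nat_per y (m : nat) : ss_f s (y + m%:R) = ss_f s y + ss_f s 1 *+ m.
  elim: m => [|m IH]; first by rewrite !addr0.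
  by rewrite -natr1 addrA ss_f_per IH mulrSr addrA.
case: (Num.floor x) => m.
  by rewrite -!pmulrn -nat_per subrK.
by rewrite NegzE !mulrNz opprK -!pmulrn nat_per addrK.
Qed.

Let dist_eq0 s t : ss_dist s t = 0 -> s = t.
Proof.
rewrite /ss_dist => d0.
have := sup_dist_ge0 s t; have := normr_ge0 (ss_tau s - ss_tau t).
have := circle_dist_ge0 (ss_l s) (ss_l t).
have := circle_dist_ge0 (ss_r s) (ss_r t) => h1 h2 h3 h4.
have /(circle_dist_eq0 (ss_l_itv s) (ss_l_itv t)) El :
  circle_dist (ss_l s) (ss_l t) = 0 by lra.
have /normr0_eq0/eqP : `|ss_tau s - ss_tau t| = 0 by lra.
rewrite subr_eq0 /ss_tau El => /eqP/addIr Er.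
have F x : 0 <= x <= 1 -> ss_f s x = ss_f t x.
  move=> /(sup_dist_ge s t) h; have : `|ss_f s x - ss_f t x| <= 0 by lra.
  by rewrite normr_le0 subr_eq0 => /eqP.
apply: scaled_state_eq => //; apply/funext => x.
rewrite (per_floor s x) (per_floor t x) (F 1) ?ler01 ?lexx// F//.
have := floor_le_tmp x; have := floorD1_gt x; rewrite intrD => a b.
by apply/andP; split; lra.
Qed.

Let dist_sym s t : ss_dist s t = ss_dist t s.
Proof.
rewrite /ss_dist (distrC (ss_tau s)) (circle_dist_sym (ss_l s)).
rewrite (circle_dist_sym (ss_r s)); congr (sup _ + _ + _ + _).
by apply/seteqP; split => _ [x hx <-]; exists x => //; rewrite distrC.
Qed.

Let dist_triangle t s u : ss_dist s u <= ss_dist s t + ss_dist t u.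
Proof.
rewrite /ss_dist.
have := circle_dist_triangle (ss_l t) (ss_l s) (ss_l u).
have := circle_dist_triangle (ss_r t) (ss_r s) (ss_r u).
have := ler_distD (ss_tau t) (ss_tau s) (ss_tau u).
suff : sup_dist (ss_f s) (ss_f u) <=
  sup_dist (ss_f s) (ss_f t) + sup_dist (ss_f t) (ss_f u) by lra.
apply: ge_sup => [|_ [x hx <-]]; first exact: (has_sup_dist s u).1.
apply: le_trans (ler_distD (ss_f t x) _ _) _.
by apply: lerD; apply: sup_dist_ge; move: hx; rewrite /= in_itv.
Qed.

HB.instance Definition _ := gen_eqMixin (scaled_state R).
HB.instance Definition _ := gen_choiceMixin (scaled_state R).
HB.instance Definition _ := isMetric.Build R (scaled_state R)
  dist_xx dist_eq0 dist_sym dist_triangle.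

Let zero_fun : R -> R := fun=> 0.
Let zero_f0 : zero_fun 0 = 0. Proof. by []. Qed.
Let zero_homo : {homo zero_fun : x y / x <= y}.
Proof. by move=> *; exact: lexx. Qed.
Let zero_per x : zero_fun (x + 1) = zero_fun x + zero_fun 1.
Proof. by rewrite /zero_fun addr0. Qed.
Let zero_itv : 0 <= (0 : R) < 1. Proof. by rewrite lexx ltr01. Qed.

HB.instance Definition _ := isPointed.Build (scaled_state R)
  (ScaledState zero_f0 zero_homo zero_per zero_itv (lexx 0)).

End ScaledStateMetric.

Section Descriptors.
Variables (R : realType) (n : nat).
Implicit Types (s : chain_state n) (x : R).

(* For x in [0, 1[ this is 1/n times the number of particles in the sites
   1, ..., floor (n x); the second summand extends it to the line. *)
Definition scaled_f s x : R :=
  (#|[set i in s.1 |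
       (1 <= i <= Num.truncn (n%:R * (x - (Num.floor x)%:~R)))%N]%SET|%:R
   + #|s.1|%:R * (Num.floor x)%:~R) / n%:R.

Definition scaled_l s : R :=
  if last_left s.1 s.2 is Some a then (a : nat)%:R / n%:R else 0.

(* The site of the rightmost particle of the cluster, measured clockwise from
   the leftmost one; there is nothing to add when there is no cluster. *)
Definition scaled_r s : R := scaled_l s + #|the_cluster s.1|.-1%:R / n%:R.

Let no_site s :
  [set i in s.1 | (1 <= (i : 'I_n) <= 0)%N]%SET = finset.set0.
Proof.
by apply/setP => i; rewrite !inE; case: (nat_of_ord i) => [|k]; rewrite andbF.
Qed.

Let scaled_f0 s : scaled_f s 0 = 0.
Proof.
by rewrite /scaled_f floor0 subrr !mulr0 addr0 truncn0 no_site cards0 mul0r.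
Qed.

Let scaled_f_homo s : {homo scaled_f s : x y / x <= y}.
Proof.
move=> x y xy; apply: ler_wpM2r; first by rewrite invr_ge0 ler0n.
have := le_floor xy; rewrite le_eqVlt => /orP[/eqP <-|lt_fl].
  rewrite lerD2r ler_nat; apply/subset_leq_card/fintype.subsetP => i.
  rewrite !inE => /andP[-> /andP[-> /=]] h; apply: leq_trans h _.
  by apply: le_truncn; rewrite ler_wpM2l ?ler0n// lerB.
have h1 : (#|[set i in s.1 |
    (1 <= i <= Num.truncn (n%:R * (x - (Num.floor x)%:~R)))%N]%SET|%:R : R)
    <= #|s.1|%:R.
  rewrite ler_nat; apply/subset_leq_card/fintype.subsetP => i.
  by rewrite !inE => /andP[].
apply: le_trans (lerD h1 (lexx _)) _.
rewrite -[leLHS]add0r; apply: lerD; first exact: ler0n.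
rewrite -[X in X + _]mulr1 -mulrDr ler_wpM2l ?ler0n// addrC.
by rewrite -[1]/(1%:~R) -intrD ler_int lezD1.
Qed.

Let scaled_f_per s x : scaled_f s (x + 1) = scaled_f s x + scaled_f s 1.
Proof.
have e : x + 1 - (Num.floor x + 1)%:~R = x - (Num.floor x)%:~R.
  by rewrite intrD; ring.
rewrite /scaled_f floor1 subrr mulr0 truncn0 no_site cards0 add0r.
rewrite floorDrz ?int_num1// floor1 e intrD.
ring.
Qed.

Let scaled_l_itv s : 0 <= scaled_l s < 1.
Proof.
rewrite /scaled_l; case: last_left => [a|]; last by rewrite lexx ltr01.
have n0 : (0 < n%:R :> R) by rewrite ltr0n (leq_ltn_trans _ (ltn_ord a)).
by rewrite divr_ge0 ?ler0n//= ltr_pdivrMr// mul1r ltr_nat.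
Qed.

Let scaled_l_le_r s : scaled_l s <= scaled_r s.
Proof. by rewrite lerDl divr_ge0 ?ler0n. Qed.

Definition descriptors s : scaled_state R :=
  ScaledState (scaled_f0 s) (@scaled_f_homo s) (scaled_f_per s)
    (scaled_l_itv s) (scaled_l_le_r s).

End Descriptors.

(* T carries its Borel sigma-algebra; since the laws of
   the descriptors have finite support, a sequence of such laws is given by its
   expectation functionals, each one a finite sum. *)

Definition bounded_continuous (R : realType) (T : topologicalType)
    (g : T -> R) : Prop :=
  continuous g /\ exists c : R, forall x, `|g x| <= c.

Definition weak_limit (R : realType) (T : ptopologicalType)
    (E : nat -> (T -> R) -> R)
    (mu : probability (g_sigma_algebraType (@open T)) R) : Prop :=
  forall g : T -> R, bounded_continuous g ->
    (fun k => (E k g)%:E) @ \oo --> (\int[mu]_x (g x)%:E)%E.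

(* Main.v *)
(** In the frame moving with the free particles, a step changes a state with a
    cluster in one place only: the hole behind the cluster jumps over it, or,
    when the head of the cluster leaves (probability p), over all of it but the
    head.  Read the circle as a walk that goes up by 1 at a particle and down
    by p at a hole; the jump leaves the mean height of the moved hole equal to
    that of the hole in front of the cluster, and rho < p / (1 + p) makes the
    total drift of the walk nonpositive.  Let D x be the supremum of the
    walk after x, minus its height at x.  When a cluster of q particles is
    passed, the walk is raised on about q sites, so the sum of D decreases by
    about q, except for the fluctuations of the supremum; these are absorbed by
    adding n times a convex function ("barrier") of D at the front of the
    cluster, with curvature 1 / L and size O(L).  This potential has drift at
    most - (q - 1) + n / (2 L) per step, and a perturbation, which has
    probability lambda / n, changes it by at most n (2 + L / 2).  Stationarity
    then gives E (q - 1) <= n / (2 L) + lambda (2 + L / 2) for every L > 0,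
    hence E tau --> 0.  The flux differs from the density by at most
    2 E tau + lambda / n. *)

Require Import Defs.
From mathcomp Require Import all_boot all_order all_algebra.
From mathcomp Require Import all_classical all_reals all_analysis.
From mathcomp Require Import measurable_realfun ring lra zify.

Set Implicit Arguments.
Unset Strict Implicit.
Unset Printing Implicit Defensive.

Import Order.TTheory GRing.Theory Num.Theory.
Import numFieldNormedType.Exports.

Local Open Scope classical_set_scope.
Local Open Scope ring_scope.

Local Notation arc := Defs.arc.
Local Notation cluster := Defs.cluster.
Local Notation kernel := Defs.kernel.

(** * Circular words and their potential *)

Lemma sum_periodic (V : nmodType) (n c : nat) (f : nat -> V) :
  (forall i, f (i + n)%N = f i) ->
  \sum_(i < n) f (c + i)%N = \sum_(i < n) f i.
Proof.
move=> per; elim: c => [//|c <-].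
case: n per => [|n] per; first by rewrite !big_ord0.
rewrite big_ord_recr [RHS]big_ord_recl /= addn0 -(per c) addrC addSnnS.
congr (_ + _).
by apply: eq_bigr => i _; rewrite addSnnS.
Qed.

Lemma sum_unique_le (R : numDomainType) (n : nat) (P : pred nat)
    (F : nat -> R) (c : R) :
  (forall i j, (i < n)%N -> (j < n)%N -> P i -> P j -> i = j) ->
  0 <= c -> (forall i, (i < n)%N -> P i -> F i <= c) ->
  \sum_(i < n) (if P i then F i else 0) <= c.
Proof.
move=> uniqP c0 Fc; case: (pickP (fun i : 'I_n => P i)) => [i Pi|noP].
  rewrite (bigD1 i) //= Pi big1 ?addr0; first exact: Fc.
  move=> j /eqP ji; case: ifP => // Pj; case: ji; apply: val_inj.
  exact: (uniqP _ _ (ltn_ord j) (ltn_ord i)).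
by rewrite big1 // => i _; rewrite noP.
Qed.

Section Words.
Variables (R : realFieldType) (n : nat) (p : R).
Hypothesis n_gt0 : (0 < n)%N.
Implicit Types (w : nat -> bool).

Definition periodic w := forall i, w (i + n)%N = w i.

Definition step (b : bool) : R := if b then 1 else - p.

Definition height w i : R := \sum_(j < i) step (w j).

(** One period of lookahead stands for the supremum over all later sites: with nonpositive drift per
    period, later periods reach no higher ([peak_ge]). *)
Definition peak w i : R :=
  \big[Num.max/0]_(m < n.+1) (height w (i + m) - height w i).

Lemma heightS w i : height w i.+1 = height w i + step (w i).
Proof. by rewrite /height big_ord_recr. Qed.

Lemma height0 w : height w 0 = 0.
Proof. by rewrite /height big_ord0. Qed.

Lemma height_add w c i :
  height w (c + i) = height w c + height (fun j => w (c + j)%N) i.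
Proof.
elim: i => [|i IH]; first by rewrite addn0 height0 addr0.
by rewrite addnS !heightS IH addrA.
Qed.

Lemma eq_height w w' i : w =1 w' -> height w i = height w' i.
Proof. by move=> e; apply: eq_bigr => j _; rewrite e. Qed.

Lemma height_periods w i c : periodic w ->
  height w (i + c * n) = height w i + height w n *+ c.
Proof.
move=> per; elim: c => [|c IH]; first by rewrite mul0n addn0 addr0.
rewrite mulSnr addnA height_add IH mulrSr addrA; congr (_ + _).
apply: (@sum_periodic _ n (i + c * n) (fun j => step (w j))) => j.
by rewrite per.
Qed.

Lemma peak_ge0 w i : 0 <= peak w i.
Proof. by rewrite /peak; apply: (bigmax_sup ord0) => //; rewrite addn0 subrr. Qed.

Lemma peak_le w i (c : R) :
  (forall y, (i <= y)%N -> height w y - height w i <= c) -> peak w i <= c.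
Proof.
move=> h; apply: bigmax_le => [|m _]; last by apply: h; rewrite leq_addr.
by rewrite -(subrr (height w i)); apply: h.
Qed.

Section Drifting.
Variable w : nat -> bool.
Hypotheses (w_per : periodic w) (w_drift : height w n <= 0).

Lemma peak_ge i y : (i <= y)%N -> height w y - height w i <= peak w i.
Proof.
move=> /subnK <-; set m := (y - i)%N.
have -> : (m + i = i + m %% n + m %/ n * n)%N by rewrite {1}(divn_eq m n); lia.
have lt_m : (m %% n < n.+1)%N by rewrite ltnS ltnW // ltn_mod.
apply: (bigmax_sup (Ordinal lt_m)) => //=.
by rewrite height_periods // lerB // gerDl mulrn_wle0.
Qed.

(** [height + peak] is the supremum of the walk over the tail from a site on, and tails shrink. *)
Lemma height_peak_anti x r :
  (x <= r)%N -> height w r + peak w r <= height w x + peak w x.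
Proof.
move=> xr; suff : peak w r <= height w x + peak w x - height w r by lra.
apply: peak_le => y ry; have := peak_ge (leq_trans xr ry); lra.
Qed.

Lemma peak_period i : peak w (i + n) = peak w i.
Proof.
apply: eq_bigr => m _.
have E j : height w (j + n) = height w j + height w n.
  by rewrite -{1}(mul1n n) height_periods.
by rewrite addnAC !E; ring.
Qed.

End Drifting.

Lemma peak_shift w c i : peak (fun j => w (c + j)%N) i = peak w (c + i).
Proof.
apply: eq_bigr => m _.
by rewrite -!addnA !(height_add w c); ring.
Qed.

Lemma eq_peak w w' i : w =1 w' -> peak w i = peak w' i.
Proof. by move=> e; apply: eq_bigr => m _; rewrite !(eq_height _ e). Qed.

(** The last two particles of a run, located by the first of them; [i.+2] is the hole in front. A
    cluster contributes one such index per period. *)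
Definition run_end w i := [&& w i, w i.+1 & ~~ w i.+2].

Variable L : R.
Hypothesis L_gt0 : 0 < L :> R.

Definition barrier (u : R) : R := (Num.max 0 (L - u)) ^+ 2 / (2 * L).

Definition potential w : R :=
  \sum_(i < n) peak w i +
  n%:R * \sum_(i < n) (if run_end w i then barrier (peak w i.+2) else 0).

Lemma eq_potential w w' : w =1 w' -> potential w = potential w'.
Proof.
move=> e; rewrite /potential; congr (_ + _ * _).
  by apply: eq_bigr => i _; exact: eq_peak.
by apply: eq_bigr => i _; rewrite /run_end !e (eq_peak _ e).
Qed.

(** Allows the drift to be computed in coordinates that start at the hole behind the cluster, before
    as well as after the step. *)
Lemma potential_shift w c : periodic w -> height w n <= 0 ->
  potential (fun j => w (c + j)%N) = potential w.
Proof.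
move=> per neg; rewrite /potential; congr (_ + _ * _).
  rewrite -(@sum_periodic _ n c (peak w)); last exact: peak_period.
  by apply: eq_bigr => i _; rewrite peak_shift.
pose F i := if run_end w i then barrier (peak w i.+2) else 0.
rewrite -(@sum_periodic _ n c F) => [|i].
  by apply: eq_bigr => i _; rewrite peak_shift /F /run_end !addnS.
by rewrite /F /run_end -!addSn !per peak_period.
Qed.

Lemma barrier_ge0 u : 0 <= barrier u.
Proof. by rewrite divr_ge0 ?sqr_ge0 // mulr_ge0 // ltW. Qed.

Lemma barrier_anti u v : u <= v -> barrier v <= barrier u.
Proof.
move=> uv; rewrite ler_pM2r; last by rewrite invr_gt0 mulr_gt0.
have ge0 (x : R) : 0 <= Num.max 0 x :> R by rewrite le_max lexx.
rewrite ler_sqr ?nnegrE //.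
by rewrite ge_max ge0 /= le_max lerB ?orbT.
Qed.

Lemma barrier_le (u : R) : 0 <= u -> barrier u <= L / 2.
Proof.
move=> /barrier_anti/le_trans; apply; rewrite /barrier subr0 max_r; last exact: ltW.
by rewrite ler_pdivrMr ?mulr_gt0 // expr2; lra.
Qed.

(* Convexity, and slope -1 at 0 so that the barrier pays for an excess over 0. *)
Lemma barrier_mean (d : R) : 0 <= p -> p <= 1 -> 0 <= d ->
  (1 - p) * (Num.max 0 (p - d) + barrier (Num.max 0 (d - p))) +
  p * (Num.max 0 (p - 1 - d) + barrier (Num.max 0 (d + 1 - p)))
    <= barrier d + (2 * L)^-1.
Proof.
have L0 := L_gt0; move=> p0 p1 d0.
have Li : 0 < (2 * L)^-1 by rewrite invr_gt0 mulr_gt0.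
(* Second-order expansion of the squared positive part, whose second derivative is at most 2. *)
have expand (u h : R) : (Num.max 0 (u + h)) ^+ 2 <=
    (Num.max 0 u) ^+ 2 + 2 * (Num.max 0 u) * h + h ^+ 2 :> R.
  by rewrite !maxEle; case: (lerP 0 u) => ?; case: (lerP 0 (u + h)) => ?; nra.
have maxE (x : R) : 0 <= x -> Num.max 0 x = x :> R by move=> ?; rewrite max_r.
have max0 (x : R) : x <= 0 -> Num.max 0 x = 0 :> R by move=> ?; rewrite max_l.
(* For [d <= p] the excess [p - d] is the linear term in the square of [L + (p - d)] divided by
   [2 * L]; this is the slope -1 at 0. *)
have E1 : Num.max 0 (p - d) + barrier (Num.max 0 (d - p)) <=
    (Num.max 0 (L - d + p)) ^+ 2 / (2 * L).
  rewrite /barrier; case: (lerP d p) => dp.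
    rewrite (maxE (p - d)) ?subr_ge0 // (max0 (d - p)) ?subr_le0 // subr0.
    rewrite !maxE; [|lra|lra].
    rewrite ler_pdivlMr ?mulr_gt0 // mulrDl divfK ?gt_eqF ?mulr_gt0 //.
    have := sqr_ge0 (p - d); nra.
  rewrite (max0 (p - d)); last lra.
  rewrite (maxE (d - p)); last lra.
  by rewrite add0r opprB addrA addrAC.
have E2 : Num.max 0 (p - 1 - d) + barrier (Num.max 0 (d + 1 - p)) =
    (Num.max 0 (L - d + (p - 1))) ^+ 2 / (2 * L).
  rewrite (max0 (p - 1 - d)); last lra.
  rewrite (maxE (d + 1 - p)); last lra.
  by rewrite add0r /barrier; congr (Num.max 0 _ ^+ 2 / _); ring.
rewrite E2.
apply: (@le_trans _ _ ((1 - p) * ((Num.max 0 (L - d + p)) ^+ 2 / (2 * L)) +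
   p * (Num.max 0 (L - d + (p - 1)) ^+ 2 / (2 * L)))).
  by rewrite lerD2r ler_wpM2l //; lra.
have F1 := expand (L - d) p; have F2 := expand (L - d) (p - 1).
rewrite /barrier; set a := Num.max 0 (L - d) in F1 F2 *.
set X := _ ^+ 2 in F1 *; set Y := _ ^+ 2 in F2 *.
(* The increments [p] and [p - 1], with weights [1 - p] and [p], have mean 0, and their second
   moment [p * (1 - p)] is at most 1. *)
have key : (1 - p) * X + p * Y <= a ^+ 2 + 1.
  have := ler_wpM2l p0 F2.
  have p1' : 0 <= 1 - p by lra.
  have := ler_wpM2l p1' F1; nra.
have := ler_wpM2r (ltW Li) key; lra.
Qed.

End Words.

(** * The one-step drift of the potential *)

Lemma sum_itv m n : (\sum_(x < n) (0 < x <= m))%N = minn n.-1 m.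
Proof.
elim: n => [|n IH]; first by rewrite big_ord0 min0n.
by rewrite big_ord_recr IH /=; lia.
Qed.

Section OneStep.
Variables (n q : nat) (w : nat -> bool).
Hypotheses (q_ge2 : (2 <= q)%N) (q_lt_n : (q.+1 < n)%N).
Hypotheses (w_hole : ~~ w 0) (w_run : forall i, (0 < i <= q)%N -> w i).
Hypotheses (w_end : ~~ w q.+1).

(* One step in the frame moving with the free particles: the hole behind the
   cluster is transferred in front of it, or, when the head of the cluster
   leaves (b = true), behind the head. *)
Definition transfer (b : bool) (w' : nat -> bool) :=
  [/\ periodic n w', forall i, (i <= q)%N -> w' i = (i != q - b)%N
    & forall i, (q < i < n)%N -> w' i = w i].

Section Transferred.
Variables (b : bool) (w' : nat -> bool).
Hypothesis tr : transfer b w'.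

(** Up to site [q] the moved hole is the only one, and beyond [q] there are no adjacent pairs, so a
    run can end only at the moved hole. The case with [+ n] is a run whose last two particles, at
    [n - 1] and 0, straddle the origin. *)
Lemma run_end_transfer i :
  (forall i, (q < i < n)%N -> ~~ (w i && w i.+1)) -> (i < n)%N -> run_end w' i ->
  i.+2 = (q - b)%N \/ i.+2 = (q - b + n)%N.
Proof.
case: tr => per h3 h4 w_isolated i_n /and3P[wi wi1 wi2].
have iq : (i < q)%N \/ i = n.-1.
  have [iq|qi|iq] := ltngtP i q; [by left | right | ]; last first.
    by move: wi1; rewrite iq h4 ?ltnSn // (negbTE w_end).
  have [//|i1n] := eqVneq i n.-1; have i1_n : (i.+1 < n)%N by lia.
  have /negP[] := w_isolated i (introT andP (conj qi i_n)).
  by rewrite -!h4 ?wi ?wi1 // ?qi // ltnW.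
case: iq => [iq|iE].
- left; case: (ltnP i.+1 q) => iq1.
    by move: wi2; rewrite h3 // negbK => /eqP.
  have Eq : q = i.+1 by apply/eqP; rewrite eqn_leq iq iq1.
  move: wi wi1; rewrite !h3 // ?Eq //; case: (b) => /=.
    by rewrite subn1 eqxx.
  by rewrite subn0 eqxx.
- right; move: wi2; have -> : i.+2 = (1 + n)%N by rewrite iE; lia.
  by rewrite per h3 ?negbK => [/eqP <-|]; lia.
Qed.

Section Heights.
Variables (R : realFieldType) (p : R).

Lemma height_run i : (0 < i <= q.+1)%N -> height p w i = i%:R - 1 - p.
Proof.
elim: i => [//|[_ _|i IH iq]].
  by rewrite heightS height0 (negbTE w_hole) /step; ring.
rewrite heightS IH; last lia.
by rewrite w_run /step; [rewrite -(natr1 i.+1); ring | lia].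
Qed.

Lemma height_transfer_run i : (i <= q.+1)%N ->
  height p w' i = i%:R - (1 + p) * (q - b < i)%:R.
Proof.
elim: i => [|i IH iq]; first by move=> _; rewrite height0 ltn0 /=; ring.
rewrite heightS IH; last lia.
case: tr => _ -> // _; rewrite /step -natr1.
case: (ltngtP i (q - b)) => h.
- have -> : (q - b < i.+1)%N = false by lia.
  by rewrite /=; ring.
- have -> : (q - b < i.+1)%N by lia.
  by rewrite /=; ring.
- have -> : (q - b < i.+1)%N by lia.
  by rewrite /=; ring.
Qed.

Lemma height_transfer_rest i : (q < i <= n)%N -> height p w' i = height p w i.
Proof.
elim: i => [//|i IH] iq; case: (ltnP q i) => h; last first.
  have -> : i = q by lia.
  rewrite height_transfer_run // height_run; last lia.
  have -> : (q - b < q.+1)%N by lia.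
  by rewrite /=; ring.
rewrite !heightS IH; last lia.
by case: tr => _ _ -> //; lia.
Qed.

End Heights.

End Transferred.

Variables (R : realFieldType) (p : R).
Hypothesis w_per : periodic n w.
Hypothesis w_isolated : forall i, (q < i < n)%N -> ~~ (w i && w i.+1).

Let n_gt0 : (0 < n)%N. Proof. lia. Qed.

Section TransferredPotential.
Variables (b : bool) (w' : nat -> bool).
Hypothesis tr : transfer b w'.

Let w'_per : periodic n w'. Proof. by case: tr. Qed.

(** Moving the hole from 0 to [q - b] turns a step [- p] into a step 1, and the gain is lost again
    at the hole's new place. *)
Lemma height_transfer y :
  height p w' y = height p w y + (1 + p) * (0 < y %% n <= q - b)%:R.
Proof.
have E : height p w' n = height p w n.
  by apply: (height_transfer_rest tr); lia.
have red v : periodic n v ->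
    height p v y = height p v (y %% n) + height p v n *+ (y %/ n).
  by move=> per; rewrite {1}(divn_eq y n) addnC height_periods.
have zn : (y %% n < n)%N by rewrite ltn_mod.
rewrite !red // E; set z := (y %% n)%N in zn *.
suff -> : height p w' z = height p w z + (1 + p) * (0 < z <= q - b)%:R by ring.
case: (posnP z) => [->|z0] /=; first by rewrite !height0; ring.
case: (ltnP q z) => h.
  rewrite (height_transfer_rest tr); last lia.
  have -> : (z <= q - b)%N = false by lia.
  by rewrite /=; ring.
rewrite (height_transfer_run tr) ?height_run; [|lia|lia].
rewrite [(z <= q - b)%N]leqNgt.
by case: (_ < _)%N => /=; ring.
Qed.

Hypotheses (p_ge0 : 0 <= p) (w_drift : height p w n <= 0).

Let w'_drift : height p w' n <= 0.
Proof. by rewrite (height_transfer_rest tr) //; lia. Qed.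

(** How far the raised walk can exceed the old supremum: raised sites reach at most height [q - b],
    while the old supremum seen from the hole [q.+1] is [q - p] plus the peak there. *)
Let excess : R := Num.max 0 (p - b%:R - peak n p w q.+1).

Lemma height_transfer_le x y : (x <= y)%N ->
  height p w' y <= height p w x + peak n p w x + excess.
Proof.
move=> xy; have p0 := p_ge0.
have ex0 : 0 <= excess by rewrite le_max lexx.
rewrite height_transfer; case: (boolP (_ && _)) => [/andP[z0 zq]|_]; last first.
  by rewrite mulr0 addr0; have := peak_ge n_gt0 w_per w_drift xy; lra.
have [c [z [Ey zq' z0']]] : exists c z,
    [/\ y = (z + c * n)%N, (z <= q - b)%N & (0 < z)%N].
  by exists (y %/ n)%N, (y %% n)%N; split=> //; rewrite addnC -divn_eq.
have [xr z_run zb] : [/\ (x <= q.+1 + c * n)%N, (0 < z <= q.+1)%N & (z + b <= q)%N].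
  by move: xy Ey zq' z0'; clear; split; lia.
have {}zb : z%:R + b%:R <= q%:R :> R by rewrite -natrD ler_nat.
(* The comparison is with the hole in front of the run in the period of [y]. It lies after [x], so
   the supremum seen from [x] is at least the one seen from it. *)
have Er : height p w (q.+1 + c * n) = q%:R - p + height p w n *+ c.
  by rewrite height_periods // height_run ?ltnS ?leqnn // -natr1; ring.
have Pr : peak n p w (q.+1 + c * n) = peak n p w q.+1.
  elim: (c) => [|c' IH]; first by rewrite mul0n addn0.
  by rewrite mulSnr addnA peak_period.
have := height_peak_anti n_gt0 w_per w_drift xr; rewrite Er Pr.
rewrite Ey height_periods // (height_run _ z_run).
have : p - b%:R - peak n p w q.+1 <= excess by rewrite le_max lexx orbT.
rewrite /= mulr1; lra.
Qed.

Lemma peak_transfer x : peak n p w' x <=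
  peak n p w x + excess - (1 + p) * (0 < x %% n <= q - b)%:R.
Proof.
apply: peak_le => y xy; have := height_transfer_le xy.
rewrite (height_transfer x); lra.
Qed.

Lemma sum_peak_transfer : \sum_(x < n) peak n p w' x <=
  \sum_(x < n) peak n p w x + n%:R * excess - (1 + p) * (q - b)%:R.
Proof.
apply: (@le_trans _ _ (\sum_(x < n)
    (peak n p w x + excess - (1 + p) * (0 < x <= q - b)%:R))).
  apply: ler_sum => x _; have := peak_transfer x.
  by rewrite (modn_small (ltn_ord x)).
rewrite !big_split /= sumr_const card_ord mulr_natl sumrN -mulr_sumr.
rewrite -natr_sum sum_itv; suff -> : minn n.-1 (q - b) = (q - b)%N by [].
lia.
Qed.

(** The moved hole has height [q - b], against [q - p] for the old front, and no height decreases. A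
    lower bound suffices because the barrier is decreasing. *)
Lemma peak_transfer_end :
  Num.max 0 (peak n p w q.+1 + b%:R - p) <= peak n p w' (q - b).
Proof.
rewrite ge_max peak_ge0 /=.
suff : peak n p w q.+1 <= peak n p w' (q - b) - b%:R + p by lra.
have p0 := p_ge0.
apply: peak_le => y qy.
have qby : (q - b <= y)%N by lia.
have := peak_ge n_gt0 w'_per w'_drift qby.
have run_q : (0 < q.+1 <= q.+1)%N by lia.
have bq : (b <= q)%N by case: b q_ge2; lia.
rewrite height_transfer (height_transfer_run tr); last lia.
rewrite ltnn (height_run _ run_q) natrB // -natr1.
case: (_ && _) => /=; lra.
Qed.

Lemma potential_transfer (L : R) : 0 < L -> potential n p L w' <=
  \sum_(x < n) peak n p w x - (1 + p) * (q - b)%:R +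
  n%:R * (excess + barrier L (Num.max 0 (peak n p w q.+1 + b%:R - p))).
Proof.
move=> L0; rewrite /potential mulrDr.
have sum_le := sum_peak_transfer.
set c := barrier L _.
suff : \sum_(i < n) (if run_end w' i then barrier L (peak n p w' i.+2) else 0)
    <= c.
  by move=> /(ler_wpM2l (ler0n R n)); lra.
apply: (@sum_unique_le _ n (run_end w')
  (fun i => barrier L (peak n p w' i.+2))); first last.
- move=> i i_n /(run_end_transfer tr w_isolated i_n) Ei; apply: barrier_anti => //.
  apply: le_trans peak_transfer_end _.
  by case: Ei => ->; rewrite ?lexx // peak_period.
- exact: barrier_ge0.
move=> i j i_n j_n /(run_end_transfer tr w_isolated i_n) +
  /(run_end_transfer tr w_isolated j_n).
by clear -i_n j_n; lia.
Qed.

End TransferredPotential.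

Hypotheses (p_ge0 : 0 <= p) (p_le1 : p <= 1) (w_drift : height p w n <= 0).


Lemma potential_ge_run (L : R) : 0 < L ->
  \sum_(x < n) peak n p w x + n%:R * barrier L (peak n p w q.+1)
    <= potential n p L w.
Proof.
move=> L0; rewrite /potential lerD2l ler_wpM2l ?ler0n //.
have qn : (q.-1 < n)%N by lia.
have Eq : q.-1.+2 = q.+1 by lia.
rewrite (bigD1 (Ordinal qn)) //=.
have -> : run_end w q.-1.
  rewrite /run_end Eq w_end.
  by apply/and3P; split=> //; apply: w_run; lia.
rewrite Eq lerDl; apply: sumr_ge0 => i _.
by case: ifP => // _; exact: barrier_ge0.
Qed.

Lemma potential_drift (L : R) w0 w1 : 0 < L ->
  transfer false w0 -> transfer true w1 ->
  (1 - p) * potential n p L w0 + p * potential n p L w1 <=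
    potential n p L w - q.-1%:R + n%:R / (2 * L).
Proof.
move=> L0 tr0 tr1; have p0 := p_ge0; have p1 := p_le1.
have q1 : q%:R = q.-1%:R + 1 :> R by rewrite natr1 prednK // ltnW.
have ge := potential_ge_run L0.
set S := \sum_(x < n) _ in ge *; set d := peak n p w q.+1 in ge *.
have d0 : 0 <= d by exact: peak_ge0.
have bm := barrier_mean L0 p0 p1 d0.
set Y0 := (Num.max 0 (p - d) + _) in bm; set Y1 := (Num.max 0 (p - 1 - d) + _) in bm.
have le0 : potential n p L w0 <= S - (1 + p) * q%:R + n%:R * Y0.
  by have := potential_transfer tr0 p0 w_drift L0; rewrite subn0 /= mulr0n subr0 addr0.
have le1 : potential n p L w1 <= S - (1 + p) * q.-1%:R + n%:R * Y1.
  by have := potential_transfer tr1 p0 w_drift L0; rewrite subn1.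
have p1' : 0 <= 1 - p by lra.
have {}le0 := ler_wpM2l p1' le0; have {}le1 := ler_wpM2l p0 le1.
have {}bm := ler_wpM2l (ler0n R n) bm.
(* The mean gain [(1 + p) * (q - p)] equals [q.-1] plus this term and the next. *)
have pQ : 0 <= p * q.-1%:R by rewrite mulr_ge0.
have pp : 0 <= (1 - p) * (1 + p) by rewrite mulr_ge0 //; lra.
rewrite q1 in le0; clear -ge le0 le1 bm pQ pp.
move: (q.-1%:R) (n%:R) (potential _ _ _ _) ge le0 le1 bm pQ pp => Q N P.
move: (potential _ _ _ _) (potential _ _ _ _) (barrier _ _) => P0 P1 bd.
by move: (2 * L)^-1 => I; lra.
Qed.

End OneStep.

(** * Occupied sites and clusters *)

Section Occupancy.
Variable n' : nat.
Local Notation n := n'.+1.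
Implicit Types (A C D M : {set 'I_n}) (i j : nat).

(** A configuration read as a periodic word on [nat]: neighbours are successors, and any site can
    serve as origin. *)
Definition occ A i : bool := (inZp i : 'I_n) \in A.

Lemma inZp_eq i j : (inZp i == inZp j :> 'I_n) = (i == j %[mod n]).
Proof. by []. Qed.

Lemma ordS_inZp i : ordS (inZp i) = inZp i.+1 :> 'I_n.
Proof. by apply: val_inj; rewrite /= -addn1 modnDml addn1. Qed.

Lemma ord_pred_inZp i : ord_pred (inZp i.+1) = inZp i :> 'I_n.
Proof. by rewrite -ordS_inZp ordSK. Qed.

Lemma occ_periodic A : periodic n (occ A).
Proof. by move=> i; rewrite /occ; congr (_ \in A); apply: val_inj; rewrite /= modnDr. Qed.

Lemma sum_inZp (V : nmodType) (F : 'I_n -> V) c :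
  \sum_(i < n) F (inZp (c + i)) = \sum_i F i.
Proof.
rewrite (@sum_periodic _ n c (fun i => F (inZp i))) => [|i].
  by apply: eq_bigr => i _; rewrite valZpK.
by congr F; apply: val_inj; rewrite /= modnDr.
Qed.

Lemma sum_occ (R : realFieldType) A c :
  \sum_(i < n) (occ A (c + i))%:R = #|A|%:R :> R.
Proof.
rewrite (sum_inZp (fun x => (x \in A)%:R)) -sum1_card natr_sum [RHS]big_mkcond.
by apply: eq_bigr => x _; case: (x \in A).
Qed.

(** For [p >= 0] the drift is nonpositive exactly when the density is at most [p / (1 + p)]; this is
    how the threshold enters. *)
Lemma height_occ (R : realFieldType) (p : R) A :
  height p (occ A) n = #|A|%:R - p * (n%:R - #|A|%:R).
Proof.
rewrite -(sum_occ R A 0) mulrBr mulr_natr -[in p *+ n](card_ord n).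
rewrite -sumr_const mulr_sumr -!sumrB; apply: eq_bigr => i _ /=.
by rewrite /step add0n; case: (occ A i) => /=; ring.
Qed.

Lemma arcE a k : arc a k = [set inZp (a + j) | j : 'I_k]%SET :> {set 'I_n}.
Proof.
apply: eq_imset => j /=; elim: (j : nat) => [|m IH].
  by rewrite addn0 valZpK.
by rewrite iterS IH ordS_inZp addnS.
Qed.

Lemma mem_arc (a : 'I_n) k t : (k <= n)%N -> (t < n)%N ->
  (inZp (a + t) \in arc a k) = (t < k)%N.
Proof.
move=> kn tn; rewrite arcE; apply/imsetP/idP => [[j _ /eqP]|tk].
  rewrite inZp_eq eqn_modDl !modn_small // => [/eqP ->//|].
  exact: leq_trans kn.
by exists (Ordinal tk).
Qed.

Lemma card_arc (a : 'I_n) k : (k <= n)%N -> #|arc a k| = k.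
Proof.
move=> kn; rewrite arcE card_imset ?card_ord // => i j /eqP.
rewrite inZp_eq eqn_modDl !modn_small => [/eqP/val_inj//| |];
  exact: leq_trans kn.
Qed.

Lemma arc_subset (a : 'I_n) k A :
  (forall t, (t < k)%N -> occ A (a + t)) -> arc a k \subset A.
Proof.
by move=> h; rewrite arcE; apply/fintype.subsetP => _ /imsetP[j _ ->]; exact: h.
Qed.

Lemma contiguous_arc (a : 'I_n) k : (k <= n)%N -> contiguous (arc a k).
Proof. by move=> kn; apply/existsP; exists a; rewrite card_arc. Qed.

Definition no_pair A := forall i, ~~ (occ A i && occ A i.+1).

(** An adjacent pair extends to a maximal contiguous set, which would be a cluster. *)
Lemma ideal_no_pair A : (2 <= n)%N -> ideal A -> no_pair A.
Proof.
move=> n2 /forallP idA i; apply/negP => /andP[occ1 occ2].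
pose D := arc (inZp i : 'I_n) 2.
have PD : contiguous D && (D \subset A).
  rewrite contiguous_arc //=; apply: arc_subset => -[|[|t]] // _.
    by rewrite addn0 /occ valZpK.
  rewrite /occ; have -> : inZp ((inZp i : 'I_n) + 1) = inZp i.+1 :> 'I_n.
    by rewrite addn1 -!ordS_inZp valZpK.
  exact: occ2.
have [C maxC sub] := maxset_exists (P := fun D => contiguous D && (D \subset A)) PD.
have /negP := idA C; apply; rewrite /cluster maxC andbT.
by rewrite -(card_arc (inZp i : 'I_n) n2) subset_leq_card.
Qed.

Lemma the_cluster_ideal A : ideal A -> the_cluster A = finset.set0.
Proof.
move=> /forallP h; rewrite /the_cluster; case: pickP => //= C cC.
by have := h C; rewrite cC.
Qed.

Lemma the_clusterP A : ~~ ideal A -> cluster A (the_cluster A).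
Proof.
rewrite negb_forall => /existsP[C]; rewrite negbK => cC.
by rewrite /the_cluster; case: pickP => //= /(_ C); rewrite cC.
Qed.

(** If a site next to either end were occupied, the arc prolonged by it would contradict maximality;
    the bound on [#|A|] makes this arc fit on the circle. *)
Lemma cluster_run A C : (#|A|.+1 < n)%N -> cluster A C ->
  exists j, [/\ ~~ occ A j, forall i, (0 < i <= #|C|)%N -> occ A (j + i)
    & ~~ occ A (j + #|C|.+1)].
Proof.
move=> An /andP[C2 /maxsetP[/andP[/existsP[a /eqP EC] CA] maxC]].
have qA := subset_leq_card CA; set q := #|C| in C2 EC qA *.
have big b : (forall t, (t < q.+1)%N -> occ A ((b : 'I_n) + t)) ->
    C \subset arc b q.+1 -> False.
  move=> hb CD; have qn : (q.+1 <= n)%N by lia.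
  have := maxC (arc b q.+1); rewrite contiguous_arc // arc_subset //.
  move=> /(_ isT CD) E; have := card_arc b qn.
  by rewrite E -/q => /eqP; rewrite ltn_eqF.
have occC t : (t < q)%N -> occ A (a + t).
  move=> tq; apply: (fintype.subsetP CA); rewrite EC mem_arc //; lia.
pose b := ord_pred a.
have ab : inZp b.+1 = a by rewrite -ordS_inZp valZpK ord_predK.
have occb t : occ A (b + t.+1) = occ A (a + t).
  rewrite /occ; congr (_ \in A); apply/eqP.
  by rewrite inZp_eq -addSnnS eqn_modDr -inZp_eq ab valZpK.
exists b; split.
- apply/negP => ob; apply: (big b) => [[|t] tq|].
  + by rewrite addn0.
  + by rewrite occb occC.
  rewrite {1}EC arcE; apply/fintype.subsetP => _ /imsetP[t _ ->].
  suff -> : inZp (a + t) = inZp (b + t.+1) :> 'I_n.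
    by rewrite mem_arc ?ltnS // ; have := ltn_ord t; lia.
  by apply/eqP; rewrite inZp_eq -addSnnS eqn_modDr -inZp_eq ab valZpK.
- by case=> [//|i] /= iq; rewrite occb occC.
- apply/negP; rewrite occb => oq; apply: (big a) => [t|].
    by rewrite ltnS leq_eqVlt => /orP[/eqP->//|]; exact: occC.
  rewrite {1}EC; apply/fintype.subsetP => x.
  rewrite !arcE => /imsetP[t _ ->]; apply/imsetP.
  by exists (widen_ord (leqnSn q) t).
Qed.

Lemma occ_move A M i :
  occ (move A M) i.+1 = (occ A i.+1 && ~~ occ M i.+1) || occ M i.
Proof.
rewrite /occ /move finset.in_setU finset.in_setD andbC; congr (_ || _).
by rewrite -ordS_inZp mem_imset //; exact: ordS_inj.
Qed.

End Occupancy.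

(** * States with at most one cluster, and their moves in the moving frame *)

Section GoodStates.
Variable n' : nat.
Local Notation n := n'.+1.
Implicit Types (A B C M : {set 'I_n}) (i j q k : nat).

(** At most one cluster, in a form that can be followed through moves and perturbations; it stands
    in for reachability. *)
Definition single_run A := forall i j,
  run_end (occ A) i -> run_end (occ A) j -> i = j %[mod n].

Definition good k A := #|A| = k /\ single_run A.

Definition run A j q := [/\ ~~ occ A j, forall i, (0 < i <= q)%N -> occ A (j + i),
  ~~ occ A (j + q.+1)
  & forall i, (q < i < n)%N -> ~~ (occ A (j + i) && occ A (j + i.+1))].

Lemma occ_mod A i j : i = j %[mod n] -> occ A i = occ A j.
Proof. by move=> e; rewrite /occ; congr (_ \in A); apply: val_inj. Qed.

Lemma run_end_mod A i j : i = j %[mod n] ->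
  run_end (occ A) i = run_end (occ A) j.
Proof.
move=> e; have e1 : i.+1 = j.+1 %[mod n].
  by apply/eqP; rewrite -(addn1 i) -(addn1 j) eqn_modDr e.
have e2 : i.+2 = j.+2 %[mod n].
  by apply/eqP; rewrite -(addn2 i) -(addn2 j) eqn_modDr e.
by rewrite /run_end (occ_mod _ e) (occ_mod _ e1) (occ_mod _ e2).
Qed.

Lemma mod_shift x c : exists2 i, (i < n)%N & x = c + i %[mod n].
Proof.
(* As [c + c * n'] is a multiple of [n], adding [c * n'] subtracts [c] modulo [n]. *)
exists ((x + c * n') %% n)%N; first by rewrite ltn_mod.
by rewrite modnDmr addnCA -mulnS addnC modnMDl.
Qed.

Lemma run_end_run A j q : (2 <= q)%N -> run A j q ->
  run_end (occ A) (j + q.-1).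
Proof.
move=> q2 [_ ru re _]; rewrite /run_end -!addnS.
have -> : q.-1.+2 = q.+1 by lia.
by rewrite re !ru //; lia.
Qed.

(** An adjacent pair off the cluster, followed up to the next hole [m], would give a second run end
    at [m.-2]. *)
Lemma single_run_run A : (#|A|.+1 < n)%N -> single_run A -> ~~ ideal A ->
  exists2 j, run A j #|the_cluster A| & (2 <= #|the_cluster A| <= #|A|)%N.
Proof.
move=> An sr /the_clusterP cC; have [j [hj ru re]] := cluster_run An cC.
move: cC => /andP[q2 /maxsetP[/andP[_ /subset_leq_card qA] _]].
set q := #|_| in ru re q2 qA *; exists j; last by rewrite q2.
split=> // i /andP[qi i_n]; apply/negP => /andP[occ1 occ2].
have exm : exists m, ~~ occ A (j + m) && (i < m)%N.
  by exists n; rewrite occ_periodic hj.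
have [m /andP[om im] mmin] := ex_minnP exm.
have m_n : (m <= n)%N by apply: mmin; rewrite occ_periodic hj.
have occm t : (i < t < m)%N -> occ A (j + t).
  move=> /andP[it tm]; apply/negPn/negP => nt.
  by have := mmin t; rewrite nt it => /(_ isT); lia.
have im1 : m != i.+1 by apply: contraNneq om => ->.
have Em : m = m.-2.+2 by lia.
have rm : run_end (occ A) (j + m.-2).
  rewrite /run_end -!addnS -Em om (occm m.-2.+1) ?andbT; last lia.
  have [->|mi] := eqVneq m.-2 i; first by rewrite occ1.
  by apply: occm; lia.
have rq : run_end (occ A) (j + q.-1).
  rewrite /run_end -!addnS; have -> : q.-1.+2 = q.+1 by lia.
  by rewrite re !ru //; lia.
have /eqP := sr _ _ rm rq; rewrite eqn_modDl !modn_small; lia.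
Qed.

Lemma card_move_ideal A : #|move A A| = #|A|.
Proof.
rewrite /move finset.setDv finset.set0U card_imset //; exact: ordS_inj.
Qed.

Lemma occ_move_ideal A i : occ (move A A) i.+1 = occ A i.
Proof. by rewrite occ_move andbN. Qed.

Lemma single_run_move_ideal A : single_run A -> single_run (move A A).
Proof.
move=> sr i j ri rj.
have [x _ ex] := mod_shift i 1; have [y _ ey] := mod_shift j 1.
rewrite (run_end_mod _ ex) in ri; rewrite (run_end_mod _ ey) in rj.
rewrite ex ey; apply/eqP; rewrite eqn_modDl; apply/eqP; apply: sr.
  by move: ri; rewrite /run_end !add1n !occ_move_ideal.
by move: rj; rewrite /run_end !add1n !occ_move_ideal.
Qed.

Definition free A : {set 'I_n} :=
  [set x in A | (ordS x \notin A) && (ord_pred x \notin A)]%SET.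

Lemma occ_free A i :
  occ (free A) i.+1 = [&& occ A i.+1, ~~ occ A i.+2 & ~~ occ A i].
Proof. by rewrite /occ inE ordS_inZp ord_pred_inZp. Qed.

Definition movers A (h : 'I_n) (b : bool) : {set 'I_n} :=
  if b then (h |: free A)%SET else free A.

Lemma occ_movers A h b i : occ (movers A h b) i =
  (b && (inZp i == h)) || occ (free A) i.
Proof. by case: b => //; rewrite /occ /movers finset.in_setU finset.in_set1. Qed.

(** The origin passes from [j] to [j.+1]: in this frame free particles stand still and blocked ones
    shift back by one, which amounts to carrying a hole over them. *)
Lemma run_transfer A j q b : (2 <= q)%N -> (q.+1 < n)%N -> run A j q ->
  transfer n q (fun i => occ A (j + i)) b
    (fun i => occ (move A (movers A (inZp (j + q)) b)) (j.+1 + i)).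
Proof.
move=> q2 qn [hj ru re iso].
have per t : occ A (j + (t + n)) = occ A (j + t) by rewrite addnA occ_periodic.
have hn : ~~ occ A (j + n) by rewrite -[n]add0n per addn0.
have eqh t : (t <= n)%N -> (inZp (j + t) == inZp (j + q) :> 'I_n) = (t == q).
  move=> tn; rewrite inZp_eq eqn_modDl (modn_small (ltnW qn)).
  case: (ltngtP t n) tn => // [tn|->] _; first by rewrite modn_small.
  rewrite modnn; lia.
have fr t : occ (free A) (j + t.+1) =
    [&& occ A (j + t.+1), ~~ occ A (j + t.+2) & ~~ occ A (j + t)].
  by rewrite !addnS occ_free.
(* Since [q >= 2], even the end particles of the cluster have an occupied neighbour. *)
have nfr t : (t <= q)%N -> occ (free A) (j + t) = false.
  case: t => [_|t tq].
    by rewrite addn0 /occ inE -/(occ A j) (negbTE hj).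
  rewrite fr; case: (posnP t) => [->|t0]; last by rewrite (ru t) ?andbF //; lia.
  by rewrite (ru 2) ?andbF //; lia.
split.
- by move=> i; rewrite addnA occ_periodic.
- move=> i iq; rewrite addSn occ_move -addnS !occ_movers !eqh; [|lia|lia].
  rewrite (nfr i) //; case: (ltnP i q) => iq'.
    rewrite nfr // ru; last lia.
    by case: b; rewrite !orbF; lia.
  have -> : i = q by lia.
  by rewrite (negbTE re); case: b; lia.
- move=> i /andP[qi i_n].
  rewrite addSn occ_move -addnS !occ_movers !eqh; [|lia|lia].
  have -> : (i.+1 == q) = false by lia.
  have -> : (i == q) = false by lia.
  rewrite !andbF /=.
  have i0 : i = i.-1.+1 by lia.
  (* Off the cluster every particle is free: [q.+1] is a hole, so the left neighbour of an occupied
     [i] also lies beyond [q]. *)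
  have -> : occ (free A) (j + i) = occ A (j + i).
    rewrite i0 fr -i0; case E : (occ A (j + i)) => //=.
    have := iso i; rewrite qi i_n E /= => -> //=.
    apply/negP => o1; have qi1 : (q < i.-1)%N.
      case: (ltngtP q i.-1) => // h; first lia.
      by move: o1 re E; rewrite [in q.+1]h -i0 => _ /negbTE ->.
    have /negP[] := iso i.-1 (introT andP (conj qi1 (leq_ltn_trans (leq_pred i) i_n))).
    by rewrite o1 -i0 E.
  have [h|h] : (i.+1 < n)%N \/ i.+1 = n by lia.
    have := iso i.+1; rewrite (leqW qi) h => /(_ isT) iso1.
    have := iso i; rewrite qi i_n => /(_ isT).
    rewrite fr; move: iso1.
    by case: (occ A (j + i)); case: (occ A (j + i.+1)); case: (occ A (j + i.+2)).
  by rewrite h (negbTE hn).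
Qed.



End GoodStates.

(** * Preservation of the single cluster, and the effect of a perturbation *)

Section MovesAndPerturbations.
Variable n' : nat.
Local Notation n := n'.+1.
Implicit Types (A B C M : {set 'I_n}) (i j q k : nat).

Section RunMove.
Variables (A : {set 'I_n}) (j q : nat).
Hypotheses (q_ge2 : (2 <= q)%N) (q_lt_n : (q.+1 < n)%N) (runA : run A j q).
Let h : 'I_n := inZp (j + q).

Lemma card_move_run b : #|move A (movers A h b)| = #|A|.
Proof.
have [hj ru re iso] := runA.
have ru0 : ~~ (fun i => occ A (j + i)) 0%N by rewrite addn0.
have tr := run_transfer b q_ge2 q_lt_n runA.
(* With [p = 0] the height over a full period counts particles, and a transfer preserves it. *)
have := height_transfer_rest q_ge2 q_lt_n ru0 ru re tr (0 : rat) (i := n).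
have hC C c : height (0 : rat) (fun i => occ C (c + i)) n = #|C|%:R.
  rewrite -(sum_occ _ C c); apply: eq_bigr => i _.
  by rewrite /step oppr0; case: occ.
by rewrite !hC => /(_ ltac:(lia)) /eqP; rewrite eqr_nat => /eqP.
Qed.

Lemma single_run_move b : single_run (move A (movers A h b)).
Proof.
have [hj ru re iso] := runA.
have ru0 : ~~ (fun i => occ A (j + i)) 0%N by rewrite addn0.
have tr := run_transfer b q_ge2 q_lt_n runA.
set C := move _ _ in tr *.
suff uniq i : run_end (occ C) i -> i.+2 = j.+1 + (q - b) %[mod n].
  move=> i1 i2 /uniq e1 /uniq e2; apply/eqP; rewrite -(eqn_modDr 2) !addn2.
  by rewrite e1 e2.
have [x x_n ex] := mod_shift n' i j.+1.
rewrite (run_end_mod _ ex) /run_end -!addnS => rx.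
have := run_end_transfer q_ge2 q_lt_n ru0 re tr iso x_n rx.
have -> : i.+2 = j.+1 + x.+2 %[mod n].
  by apply/eqP; rewrite -(addn2 i) -(addn2 x) addnA eqn_modDr ex.
by case=> ->; rewrite // addnA modnDr.
Qed.

Lemma card_free_run : (#|A| <= #|free A| + q)%N.
Proof.
have [hj ru re iso] := runA.
rewrite -(cardsID (free A) A); apply: leq_add.
  by apply/subset_leq_card/fintype.subsetP => x; rewrite inE => /andP[].
suff sub : A :\: free A \subset [set inZp (j + t.+1) | t : 'I_q]%SET.
  apply: leq_trans (subset_leq_card sub) _.
  by apply: leq_trans (leq_imset_card _ _) _; rewrite card_ord.
apply/fintype.subsetP => x; rewrite inE => /andP[xf xA].
have [t t_n ex] := mod_shift n' x j.
have Ex : x = inZp (j + t) by rewrite -[x]valZpK; apply: val_inj.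
case: (posnP t) => [t0|t0].
  by move: hj; rewrite /occ -[j]addn0 -t0 -Ex xA.
case: (leqP t q) => tq.
  have tq' : (t.-1 < q)%N by lia.
  by apply/imsetP; exists (Ordinal tq'); rewrite //= prednK.
case/negP: xf; rewrite Ex -/(occ (free A) (j + t)) -[t]prednK // addnS occ_free.
have oxt : occ A (j + t) by rewrite /occ -Ex.
rewrite -!addnS prednK // oxt /=; apply/andP; split.
  by have := iso t; rewrite tq t_n oxt => /(_ isT).
have := iso t.-1; rewrite prednK // oxt andbT; apply.
case: (ltngtP q t.-1) => // hq; [lia|lia|].
by move: re oxt; rewrite hq prednK // => /negbTE ->.
Qed.

End RunMove.

Lemma card_swap C (x y : 'I_n) : x \in C -> y \in ~: (C :\ x) ->
  #|y |: (C :\ x)| = #|C|.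
Proof. by move=> xC; rewrite inE cardsU1 => ->; rewrite (cardsD1 x C) xC. Qed.

(** Every new pair contains [y], so a run end has [y] as its first or as its second particle. The
    first case makes the site after [y] occupied, the second makes it a hole, so all run ends are of
    the same type. *)
Lemma single_run_swap C (x y : 'I_n) : no_pair C ->
  single_run (y |: (C :\ x)).
Proof.
move=> np; set B := y |: _.
have occB i : occ B i -> (inZp i == y) || occ C i.
  by rewrite /occ !inE => /orP[->//|/andP[_ ->]]; rewrite orbT.
have meet i : run_end (occ B) i -> inZp i = y \/ inZp i.+1 = y.
  move=> /and3P[/occB/orP[/eqP e|ci] /occB/orP[/eqP e1|ci1] _];
    [by left|by left|by right|].
  by have /negP[] := np i; rewrite ci.
move=> i i' ri ri'.
have inj u v : inZp u = y -> inZp v = y -> u = v %[mod n].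
  by move=> <- /(congr1 val).
have S u v : u.+1 = v.+1 %[mod n] -> u = v %[mod n].
  by move=> /eqP; rewrite -(addn1 u) -(addn1 v) eqn_modDr => /eqP.
have contra u v : run_end (occ B) u -> run_end (occ B) v ->
    inZp u = y -> inZp v.+1 = y -> False.
  move=> /and3P[_ u1 _] /and3P[_ _ v2] eu ev; move: v2.
  rewrite (@occ_mod _ _ v.+2 u.+1) ?u1 //.
  by apply/eqP; rewrite -(addn1 u) -(addn1 v.+1) eqn_modDr; apply/eqP/inj.
case: (meet _ ri) => e; case: (meet _ ri') => e'.
- exact: inj.
- by case: (contra _ _ ri ri').
- by case: (contra _ _ ri' ri).
- exact/S/inj.
Qed.

(** Removing [x] can only lower a step, and inserting [y] raises one by at most [1 + p <= 2]; a
    window of at most [n] sites meets [y] at most once. *)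
Lemma peak_swap (R : realFieldType) (p : R) C (x y : 'I_n) i :
  0 <= p -> p <= 1 -> peak n p (occ (y |: (C :\ x))) i <= peak n p (occ C) i + 2.
Proof.
move=> p0 p1; set B := y |: _; apply: bigmax_le => [|m _].
  by rewrite addr_ge0 ?peak_ge0.
apply: (@le_trans _ _ (height p (occ C) (i + m) - height p (occ C) i + 2)).
  have E D : height p (occ D) (i + m) - height p (occ D) i =
      height p (fun l => occ D (i + l)) m by rewrite height_add addrC addKr.
  rewrite !E.
  apply: (@le_trans _ _ (height p (fun l => occ C (i + l)) m
      + \sum_(l < m) 2 * (occ [set y]%SET (i + l))%:R)).
    rewrite -big_split; apply: ler_sum => l _ /=.
    rewrite /occ /B !inE; set z := inZp _.
    case: (z == y) => /=; last by case: (z == x); case: (z \in C) => /=; rewrite /step; lra.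
    by case: (z \in C); rewrite /step /=; lra.
  rewrite lerD2l -mulr_sumr -[leRHS]mulr1 ler_wpM2l //.
  have E1 : 1 = \sum_(l < n) (occ [set y]%SET (i + l))%:R :> R.
    by rewrite sum_occ cards1.
  have mn : (m <= n)%N by rewrite -ltnS.
  rewrite [leRHS]E1 (big_ord_widen n (fun l => (occ [set y]%SET (i + l))%:R)) //.
  by rewrite [leRHS](bigID (fun l : 'I_n => l < m)%N) /= lerDl sumr_ge0.
by rewrite lerD2r; apply: (bigmax_sup m).
Qed.

Lemma potential_swap (R : realFieldType) (p L : R) C (x y : 'I_n) :
  0 <= p -> p <= 1 -> 0 < L -> no_pair C ->
  potential n p L (occ (y |: (C :\ x))) <=
    potential n p L (occ C) + n%:R * (2 + L / 2).
Proof.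
move=> p0 p1 L0 np; set B := y |: _; rewrite {1}/potential mulrDr addrA.
apply: lerD.
  apply: (@le_trans _ _ (\sum_(i < n) peak n p (occ C) i + n%:R * 2)).
    have -> : n%:R * 2 = \sum_(i < n) (2 : R) by rewrite sumr_const card_ord mulr_natl.
    by rewrite -big_split; apply: ler_sum => i _; exact: peak_swap.
  rewrite lerD2r lerDl mulr_ge0 ?ler0n // sumr_ge0 // => i _.
  by case: ifP => // _; exact: barrier_ge0.
rewrite ler_wpM2l ?ler0n //.
apply: (@sum_unique_le _ n (run_end (occ B))
  (fun i => barrier L (peak n p (occ B) i.+2))).
- move=> i i' i_n i'_n r r'; have := single_run_swap np r r'.
  by rewrite !modn_small.
- by rewrite divr_ge0 // ltW.
by move=> i _ _; apply: barrier_le => //; exact: peak_ge0.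
Qed.

End MovesAndPerturbations.

(** * Expectations over one step *)

(** When all elements but [h] decide with certainty, just two sets of movers have nonzero weight. *)
Lemma sum_independent_choices (R : comPzRingType) (T : finType) (A M0 : {set T})
    (f : T -> R) (h : T) (F : {set T} -> R) :
  h \in A -> M0 \subset A -> h \notin M0 ->
  {in A, forall x, x != h -> f x = (x \in M0)%:R} ->
  \sum_(M : {set T} | M \subset A)
      (\prod_(x in A) (if x \in M then f x else 1 - f x)) * F M =
    (1 - f h) * F M0 + f h * F (h |: M0).
Proof.
move=> hA M0A hM0 fM0.
have prodE M : (forall x, x != h -> (x \in M) = (x \in M0)) ->
    \prod_(x in A) (if x \in M then f x else 1 - f x) =
    if h \in M then f h else 1 - f h.
  move=> MM0; rewrite (bigD1 h) //= big1 ?mulr1 // => x /andP[xA xh].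
  by rewrite MM0 // fM0 //; case: (x \in M0); rewrite ?subr0.
have hU : (h |: M0)%SET != M0.
  by apply: contraNneq hM0 => <-; rewrite finset.in_setU1 eqxx.
rewrite (bigD1 M0) //= prodE // (negbTE hM0); congr (_ + _).
rewrite (bigD1 (h |: M0)%SET) /=; last first.
  by rewrite hU andbT finset.subUset finset.sub1set hA.
rewrite prodE => [|x xh]; last by rewrite finset.in_setU1 (negbTE xh).
rewrite finset.in_setU1 eqxx /= big1 ?addr0 // => M /andP[/andP[MA MM0] MU].
suff [x xA /andP[xh xM]] : exists2 x, x \in A & (x != h) && ((x \in M) != (x \in M0)).
  rewrite (bigD1 x) //= fM0 //.
  by move: xM; case: (x \in M); case: (x \in M0); rewrite //= ?subrr !mul0r.
apply/exists_inP; apply: contraT => /exists_inPn none.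
have eqM x : x != h -> (x \in M) = (x \in M0).
  move=> xh; case xA : (x \in A).
    by have := none _ xA; rewrite xh /= negbK => /eqP.
  apply/idP/idP => xM; first by rewrite (fintype.subsetP MA) in xA.
  by rewrite (fintype.subsetP M0A) in xA.
case hM : (h \in M); [case/eqP: MU | case/eqP: MM0]; apply/setP => x.
  rewrite finset.in_setU1; have [->|xh] /= := eqVneq x h; first by rewrite hM.
  exact: eqM.
have [->|xh] := eqVneq x h; first by rewrite hM (negbTE hM0).
exact: eqM.
Qed.

Lemma sum_certain_choices (R : comPzRingType) (T : finType) (A : {set T})
    (f : T -> R) (F : {set T} -> R) : {in A, forall x, f x = 1} ->
  \sum_(M : {set T} | M \subset A)
      (\prod_(x in A) (if x \in M then f x else 1 - f x)) * F M = F A.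
Proof.
move=> f1; rewrite (bigD1 A) //= big1 ?mul1r => [|x xA]; last by rewrite xA f1.
rewrite big1 ?addr0 // => M /andP[MA MneA].
have /subsetPn[x xA xM] : ~~ (A \subset M).
  by apply: contra MneA => AM; rewrite finset.eqEsubset MA.
by rewrite (bigD1 x) //= (negbTE xM) f1 // subrr !mul0r.
Qed.

Section StepMean.
Variables (R : realType) (n' : nat) (p lambda : R).
Local Notation n := n'.+1.
Implicit Types (A B C M : {set 'I_n}) (g : {set 'I_n} -> nat -> R).

(** The inner expectation of [step_mean], once the movers have been chosen. *)
Definition perturbed_mean C m g : R :=
  if ideal C then
    (1 - lambda / n%:R) * g C m +
    lambda / n%:R * perturb_mean C (fun B d => g B (m + d)%N)
  else g C m.

Lemma inZpS_surj (x : 'I_n) : exists i, x = inZp i.+1.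
Proof.
exists (x + n')%N; rewrite -addnS -[LHS]valZpK.
by apply: val_inj; rewrite /= modnDr.
Qed.

Lemma step_mean_ideal A g : no_pair A ->
  step_mean p lambda A g = perturbed_mean (move A A) #|A| g.
Proof.
move=> np; apply: sum_certain_choices => x xA.
have [i Ei] := inZpS_surj x; rewrite /move_prob Ei ordS_inZp ord_pred_inZp.
rewrite Ei in xA; have := np i.+1; rewrite /occ xA /= => /negbTE ->.
by have := np i; rewrite /occ xA andbT => /negbTE ->.
Qed.

(** A particle that is held back is the second particle of a run end; with a single run only the
    head of the cluster qualifies, so it alone moves at random. *)
Lemma step_mean_run A j q g : (2 <= q)%N -> run A j q -> single_run A ->
  step_mean p lambda A g =
    (1 - p) * perturbed_mean (move A (movers A (inZp (j + q)) false))
                #|movers A (inZp (j + q)) false| g +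
    p * perturbed_mean (move A (movers A (inZp (j + q)) true))
          #|movers A (inZp (j + q)) true| g.
Proof.
move=> q2 rn sr; have [hj ru re iso] := rn.
set h : 'I_n := inZp (j + q).
have hA : h \in A by apply: ru; lia.
have Eq : (j + q = (j + q.-1).+1)%N by lia.
have hS : ordS h \notin A by rewrite /h ordS_inZp -addnS.
have hp : ord_pred h \in A by rewrite /h Eq ord_pred_inZp; apply: ru; lia.
have ph : move_prob p A h = p by rewrite /move_prob (negbTE hS) hp.
rewrite -[in RHS]ph.
apply: (@sum_independent_choices _ _ _ _ (move_prob p A) h
  (fun M => perturbed_mean (move A M) #|M| g)) => //.
- by apply/fintype.subsetP => x; rewrite inE => /andP[].
- by rewrite inE hp !andbF.
move=> x xA xh; rewrite inE xA /= /move_prob.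
case: ifP => //= xS; case: ifP => //= xp.
case/eqP: xh; have [i Ei] := inZpS_surj x.
rewrite Ei ord_pred_inZp ordS_inZp in xA xS xp *.
have ri : run_end (occ A) i by rewrite /run_end /occ xp xA xS.
have /eqP := sr _ _ ri (run_end_run q2 rn).
rewrite -(eqn_modDr 1) !addn1 -Eq => /eqP e.
exact: val_inj.
Qed.

Lemma perturb_mean_le C (f : {set 'I_n} -> nat -> R) c :
  (0 < #|C|)%N -> (#|C| < n)%N ->
  (forall x y, x \in C -> y \in ~: (C :\ x) ->
    f (y |: (C :\ x)) (cw_dist x y) <= c) ->
  perturb_mean C f <= c.
Proof.
move=> C0 Cn fc; rewrite /perturb_mean ler_pdivrMr ?ltr0n // mulr_natr -sumr_const.
apply: ler_sum => x xC.
have holes : (0 < #|~: (C :\ x)|)%N.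
  by rewrite card_gt0; apply/set0Pn; exists x; rewrite !inE eqxx.
rewrite ler_pdivrMr ?ltr0n // mulr_natr -sumr_const.
by apply: ler_sum => y yC; exact: fc.
Qed.

Lemma perturb_mean_opp C (f : {set 'I_n} -> nat -> R) :
  perturb_mean C (fun B d => - f B d) = - perturb_mean C f.
Proof.
rewrite /perturb_mean -mulNr -sumrN; congr (_ / _); apply: eq_bigr => x _.
by rewrite -mulNr -sumrN.
Qed.

Lemma perturb_mean_ge C (f : {set 'I_n} -> nat -> R) c :
  (0 < #|C|)%N -> (#|C| < n)%N ->
  (forall x y, x \in C -> y \in ~: (C :\ x) ->
    c <= f (y |: (C :\ x)) (cw_dist x y)) ->
  c <= perturb_mean C f.
Proof.
move=> C0 Cn fc; rewrite -lerN2 -perturb_mean_opp; apply: perturb_mean_le => //.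
by move=> x y xC yC; rewrite lerN2 fc.
Qed.

Lemma perturb_mean_sum (I : finType) C (f : I -> {set 'I_n} -> nat -> R)
    (c : I -> R) :
  \sum_i perturb_mean C (f i) * c i =
    perturb_mean C (fun B d => \sum_i f i B d * c i).
Proof.
rewrite /perturb_mean; under eq_bigr do rewrite mulrAC mulr_suml.
rewrite -mulr_suml exchange_big /=; congr (_ / _); apply: eq_bigr => x _.
under eq_bigr do rewrite mulrAC mulr_suml.
by rewrite -mulr_suml exchange_big.
Qed.

Lemma perturbed_mean_sum (I : finType) C m (f : I -> {set 'I_n} -> nat -> R)
    (c : I -> R) :
  \sum_i perturbed_mean C m (f i) * c i =
    perturbed_mean C m (fun B d => \sum_i f i B d * c i).
Proof.
rewrite /perturbed_mean; case: ifP => // _.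
under eq_bigr do rewrite mulrDl -(mulrA (1 - _)) -(mulrA (lambda / n%:R)).
by rewrite big_split /= -!mulr_sumr
  (perturb_mean_sum C (fun i B d => f i B (m + d)%N)).
Qed.

Lemma step_mean_sum (I : finType) A (f : I -> {set 'I_n} -> nat -> R)
    (c : I -> R) :
  \sum_i step_mean p lambda A (f i) * c i =
    step_mean p lambda A (fun B d => \sum_i f i B d * c i).
Proof.
rewrite /step_mean; under eq_bigr do rewrite mulr_suml.
rewrite exchange_big /=; apply: eq_bigr => M _.
under eq_bigr do rewrite -mulrA.
rewrite -mulr_sumr; congr (_ * _).
exact: (perturbed_mean_sum _ #|M|).
Qed.

Lemma kernel_mean A (f : {set 'I_n} -> R) :
  \sum_B kernel p lambda A B * f B = step_mean p lambda A (fun B _ => f B).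
Proof.
rewrite step_mean_sum; congr step_mean; apply/funext => B; apply/funext => d.
rewrite (bigD1 B) //= eqxx mul1r big1 ?addr0 // => B' /negbTE BB'.
by rewrite eq_sym BB' mul0r.
Qed.

End StepMean.

(** * Invariance of good states and one-step bounds for the process *)

Section OneStepEstimates.
Variables (R : realType) (n' : nat) (p lambda : R) (k : nat).
Local Notation n := n'.+1.
Implicit Types (A B C M : {set 'I_n}) (g : {set 'I_n} -> nat -> R).
Hypothesis k_lt_n : (k.+1 < n)%N.

Let n_ge2 : (2 <= n)%N. Proof. exact: leq_trans k_lt_n. Qed.

(** This is [n] times tau. It is 0 for an ideal state, where [the_cluster] is empty and the
    predecessor of 0 is 0. *)
Let excess A : nat := #|the_cluster A|.-1.

Lemma good_run A : good k A -> ~~ ideal A ->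
  exists2 j, run A j #|the_cluster A| & (2 <= #|the_cluster A| <= k)%N.
Proof. by move=> [cA sA] nid; rewrite -cA; apply: single_run_run; rewrite ?cA. Qed.

Lemma good_swap C (x y : 'I_n) : good k C -> no_pair C ->
  x \in C -> y \in ~: (C :\ x) -> good k (y |: (C :\ x)).
Proof.
by move=> [cC sC] np xC yC; split; [rewrite card_swap | exact: single_run_swap].
Qed.

Lemma good_move_ideal A : good k A -> good k (move A A).
Proof.
by move=> [cA sA]; split; [rewrite card_move_ideal | exact: single_run_move_ideal].
Qed.

Lemma good_move_run A j q b : (2 <= q <= k)%N -> run A j q -> good k A ->
  good k (move A (movers A (inZp (j + q)) b)).
Proof.
move=> /andP[q2 qk] rA [cA sA]; have qn : (q.+1 < n)%N by exact: leq_ltn_trans k_lt_n.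
by split; [rewrite card_move_run | exact: single_run_move].
Qed.

Lemma perturbed_mean_eq0 C m g : good k C ->
  (forall B d, good k B -> g B d = 0) -> perturbed_mean lambda C m g = 0.
Proof.
move=> gC g0; rewrite /perturbed_mean (g0 C) //; case: ifP => // idC.
have np := ideal_no_pair n_ge2 idC.
rewrite mulr0 add0r /perturb_mean big1 ?mul0r ?mulr0 // => x xC.
by rewrite big1 ?mul0r // => y yC; apply: g0; exact: good_swap.
Qed.

Lemma good_step A B : good k A -> 0 < kernel p lambda A B -> good k B.
Proof.
move=> gA kAB; apply: contrapT => nB; move: kAB; suff -> : kernel p lambda A B = 0.
  by rewrite ltxx.
have g0 B' (d : nat) : good k B' -> (B' == B)%:R = 0 :> R.
  by move=> gB'; case: eqP => // E; case: nB; rewrite -E.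
rewrite /kernel; have [idA|nidA] := boolP (ideal A).
  rewrite step_mean_ideal; last exact: ideal_no_pair.
  by apply: perturbed_mean_eq0 => //; exact: good_move_ideal.
have [j rA qk] := good_run gA nidA; have /andP[q2 _] := qk.
rewrite (step_mean_run _ _ _ q2 rA); last by case: gA.
by rewrite !perturbed_mean_eq0 ?mulr0 ?addr0 //; exact: good_move_run.
Qed.

Lemma good_cluster A : #|A| = k -> cluster A A -> good k A.
Proof.
move=> cA /andP[_ /maxsetP[/andP[/existsP[a /eqP EA] _] _]].
split=> //; rewrite cA in EA.
have kn : (k <= n)%N by lia.
have pos i : run_end (occ A) i -> i = a + k.-2 %[mod n].
  have [t t_n e] := mod_shift n' i a; rewrite (run_end_mod _ e) e => r.
  congr ((_ + _) %% _)%N; move: r; rewrite /run_end -!addnS /occ EA mem_arc //.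
  move=> /and3P[tk]; rewrite mem_arc //; last lia.
  by move=> t1k; rewrite mem_arc //; lia.
by move=> i1 i2 /pos -> /pos ->.
Qed.

Lemma admissible_good B : admissible p lambda k B -> good k B.
Proof.
move=> /existsP[A /and3P[/eqP cA clA /connectP[s + ->]]].
elim: s A cA clA {B} => [|B s IH] A cA clA /=.
  by move=> _; exact: good_cluster.
have : good k A by exact: good_cluster.
move: {IH cA clA} A B; elim: s => [|C s IH] A B gA /=.
  by move=> /andP[/(good_step gA)].
by move=> /andP[/(good_step gA) gB]; exact: IH.
Qed.

Hypotheses (p_ge0 : 0 <= p) (p_le1 : p <= 1) (lambda_ge0 : 0 <= lambda).
Hypothesis k_gt0 : (0 < k)%N.

(** A relocation has probability [lambda / n] and covers a distance less than [n]. *)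
Lemma perturbed_mean_dist C m : good k C ->
  m%:R <= perturbed_mean lambda C m (fun _ d => d%:R) <= m%:R + lambda.
Proof.
move=> gC; have l0 := lambda_ge0.
rewrite /perturbed_mean; case: ifP => [idC|_]; last by rewrite lexx lerDl.
have [cC _] := gC; have ln0 : 0 <= lambda / n%:R by rewrite divr_ge0.
set P := perturb_mean _ _.
have ge : m%:R <= P.
  by apply: perturb_mean_ge; rewrite ?cC // 1?ltnW // => x y _ _; rewrite ler_nat leq_addr.
have le : P <= m%:R + n%:R.
  apply: perturb_mean_le; rewrite ?cC // 1?ltnW // => x y _ _.
  by rewrite -natrD ler_nat leq_add2l ltnW // ltn_mod.
have {}ge := ler_wpM2l ln0 ge; have := ler_wpM2l ln0 le.
rewrite [X in _ <= X]mulrDr divfK ?pnatr_eq0 // => {}le.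
by move: (lambda / n%:R) ge le => c ge le; apply/andP; split; lra.
Qed.

(** At least [k - q] particles move when the cluster has [q] particles, and [q <= 2 * (q - 1)]
    because [q >= 2]. *)
Lemma psi_bounds A : good k A ->
  k%:R - 2 * (excess A)%:R <= psi p lambda A <= k%:R + lambda.
Proof.
move=> gA; have [cA sA] := gA; have p0 := p_ge0; have p1 := p_le1.
rewrite /psi; have [idA|nidA] := boolP (ideal A).
  rewrite step_mean_ideal; last exact: ideal_no_pair.
  have := perturbed_mean_dist #|A| (good_move_ideal gA).
  by rewrite /excess the_cluster_ideal // cards0 cA mulr0 subr0.
have [j rA qk] := good_run gA nidA; have /andP[q2 qlek] := qk.
rewrite (step_mean_run _ _ _ q2 rA) // /excess.
set q := #|_| in rA qk q2 qlek *; have qn : (q.+1 < n)%N by exact: leq_ltn_trans k_lt_n.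
set M := fun b => movers A (inZp (j + q)) b.
have gC b : good k (move A (M b)) by exact: good_move_run.
have M_le b : (#|M b| <= k)%N.
  rewrite -cA; apply/subset_leq_card/fintype.subsetP => x; rewrite /M /movers.
  have [_ ru _ _] := rA; have hA : inZp (j + q) \in A by apply: ru; lia.
  by case: b; rewrite !inE; [case/orP=> [/eqP->|/andP[]]|case/andP].
have M_ge b : (k <= #|M b| + q)%N.
  rewrite -cA; apply: leq_trans (card_free_run q2 qn rA) _; rewrite leq_add2r.
  apply/subset_leq_card/fintype.subsetP => x; rewrite /M /movers; case: b => //.
  by rewrite !inE => ->; rewrite orbT.
have bnd b : k%:R - 2 * q.-1%:R <=
    perturbed_mean lambda (move A (M b)) #|M b| (fun _ d => d%:R) <= k%:R + lambda.
  have /andP[lo hi] := perturbed_mean_dist #|M b| (gC b).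
  apply/andP; split.
    apply: le_trans lo; rewrite lerBlDr -natrM -natrD ler_nat.
    by apply: leq_trans (M_ge b) _; rewrite leq_add2l; lia.
  by apply: le_trans hi _; rewrite lerD2r ler_nat.
have /andP[lo0 hi0] := bnd false; have /andP[lo1 hi1] := bnd true.
have p1' : 0 <= 1 - p by lra.
have := ler_wpM2l p1' lo0; have := ler_wpM2l p1' hi0.
have := ler_wpM2l p0 lo1; have := ler_wpM2l p0 hi1.
by move=> *; apply/andP; split; lra.
Qed.

Hypothesis k_small : k%:R <= p * (n%:R - k%:R).

Lemma height_shifted_le0 A c : #|A| = k -> height p (fun i => occ A (c + i)) n <= 0.
Proof.
move=> cA; have -> : height p (fun i => occ A (c + i)) n = height p (occ A) n.
  by apply: (@sum_periodic _ n c (fun i => step p (occ A i))) => i; rewrite occ_periodic.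
by have := k_small; rewrite height_occ cA; lra.
Qed.

Lemma height_occ_le0 A : #|A| = k -> height p (occ A) n <= 0.
Proof. exact: (height_shifted_le0 0). Qed.

Section Potential.
Variable L : R.
Hypothesis L_gt0 : 0 < L.

Let Phi A := potential n p L (occ A).

Lemma perturbed_mean_potential C m : good k C ->
  perturbed_mean lambda C m (fun B _ => Phi B) <= Phi C + lambda * (2 + L / 2).
Proof.
move=> gC; have L0 := L_gt0; have l0 := lambda_ge0.
have K0 : 0 <= lambda * (2 + L / 2) by rewrite mulr_ge0 // addr_ge0 // divr_ge0 // ltW.
rewrite /perturbed_mean; case: ifP => [idC|_]; last by rewrite lerDl.
have np := ideal_no_pair n_ge2 idC; have [cC _] := gC.
have ln0 : 0 <= lambda / n%:R by rewrite divr_ge0.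
have : perturb_mean C (fun B _ => Phi B) <= Phi C + n%:R * (2 + L / 2).
  by apply: perturb_mean_le; rewrite ?cC // 1?ltnW // => x y xC yC; exact: potential_swap.
move=> /(ler_wpM2l ln0) le; apply: le_trans (lerD (lexx _) le) _.
have E K : lambda / n%:R * (n%:R * K) = lambda * K by rewrite mulrA divfK ?pnatr_eq0.
by rewrite (mulrDr (lambda / n%:R)) E mulrBl mul1r addrA subrK.
Qed.

Lemma step_mean_potential A : good k A ->
  step_mean p lambda A (fun B _ => Phi B) <=
    Phi A - (excess A)%:R + n%:R / (2 * L) + lambda * (2 + L / 2).
Proof.
move=> gA; have [cA sA] := gA; have p0 := p_ge0; have p1 := p_le1.
have nL0 : 0 <= n%:R / (2 * L) by rewrite divr_ge0 // mulr_ge0 // ltW.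
have [idA|nidA] := boolP (ideal A).
  rewrite step_mean_ideal; last exact: ideal_no_pair.
  have := perturbed_mean_potential #|A| (good_move_ideal gA).
  (* From an ideal state all particles move, so the step is a rotation of the circle. *)
  have -> : Phi (move A A) = Phi A.
    rewrite /Phi -(@potential_shift _ n _ _ (occ (move A A)) 1).
    - by apply: eq_potential => i; rewrite add1n occ_move_ideal.
    - exact: occ_periodic.
    - by apply: height_occ_le0; rewrite card_move_ideal.
  by rewrite /excess the_cluster_ideal // cards0 subr0; lra.
have [j rA qk] := good_run gA nidA; have /andP[q2 qlek] := qk.
rewrite (step_mean_run _ _ _ q2 rA) // /excess.
set q := #|_| in rA qk q2 qlek *; have qn : (q.+1 < n)%N by exact: leq_ltn_trans k_lt_n.
set C := fun b => move A (movers A (inZp (j + q)) b).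
have gC b : good k (C b) by exact: good_move_run.
have shiftE D c : good k D -> potential n p L (fun i => occ D (c + i)) = Phi D.
  by move=> [cD _]; apply: potential_shift; [exact: occ_periodic|exact: height_occ_le0].
have [hj ru re iso] := rA.
have hj0 : ~~ occ A (j + 0) by rewrite addn0.
have per : periodic n (fun i => occ A (j + i)) by move=> i; rewrite addnA occ_periodic.
have := potential_drift q2 qn hj0 ru re per iso p0 p1 (height_shifted_le0 j cA) L_gt0
  (run_transfer false q2 qn rA) (run_transfer true q2 qn rA).
rewrite (shiftE _ _ gA) (shiftE _ _ (gC false)) (shiftE _ _ (gC true)) => drift.
have := perturbed_mean_potential #|movers A (inZp (j + q)) false| (gC false).
have := perturbed_mean_potential #|movers A (inZp (j + q)) true| (gC true).
have p1' : 0 <= 1 - p by lra.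
move=> /(ler_wpM2l p0) le1 /(ler_wpM2l p1') le0.
move: drift le1 le0; rewrite -/(C false) -/(C true) => drift le1 le0.
rewrite mulrDr in le0; rewrite mulrDr in le1; lra.
Qed.

End Potential.

End OneStepEstimates.

(** * Stationary estimates and limits *)

Section Stationarity.
Variables (R : realType) (n : nat) (p lambda : R) (k : nat).
Variable P : chain_state n -> R.
Hypothesis P_stationary : stationary p lambda k P.

Lemma mean_le (f g : chain_state n -> R) :
  (forall s, admissible p lambda k s.1 -> f s <= g s) -> mean P f <= mean P g.
Proof.
have [P0 _ Pz _] := P_stationary => fg; apply: ler_sum => s _.
have [/fg|/Pz ->] := boolP (admissible p lambda k s.1); last by rewrite !mul0r.
exact: ler_wpM2l.
Qed.

Lemma mean_cst c : mean P (fun=> c) = c.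
Proof. by have [_ P1 _ _] := P_stationary; rewrite /mean -mulr_suml P1 mul1r. Qed.

Lemma meanD (f g : chain_state n -> R) :
  mean P (fun s => f s + g s) = mean P f + mean P g.
Proof. by rewrite /mean -big_split; apply: eq_bigr => s _; rewrite mulrDr. Qed.

Lemma meanZ c (f : chain_state n -> R) : mean P (fun s => c * f s) = c * mean P f.
Proof. by rewrite /mean mulr_sumr; apply: eq_bigr => s _; rewrite mulrCA. Qed.

(** The recorded site is determined by the new configuration and the old record, so it sums out. *)
Lemma stationary_mean (f : {set 'I_n} -> R) :
  mean P (fun s => f s.1) =
    mean P (fun s => \sum_B kernel p lambda s.1 B * f B).
Proof.
have [_ _ _ Pst] := P_stationary; rewrite /mean.
under eq_bigr do rewrite Pst mulr_suml.
rewrite exchange_big /=; apply: eq_bigr => s _.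
under eq_bigr do rewrite -mulrA.
rewrite -mulr_sumr; congr (_ * _); rewrite /trans.
rewrite -(pair_bigA _ (fun B m =>
  kernel p lambda s.1 B * (m == last_left B s.2)%:R * f B)) /=.
apply: eq_bigr => B _; rewrite (bigD1 (last_left B s.2)) //= eqxx mulr1.
by rewrite big1 ?addr0 // => m /negbTE ->; rewrite mulr0 mul0r.
Qed.

End Stationarity.

Definition tau (R : realType) n (s : chain_state n) : R :=
  ss_tau (descriptors R s).

Lemma tauE (R : realType) n (s : chain_state n) :
  tau R s = #|the_cluster s.1|.-1%:R / n%:R.
Proof. by rewrite /tau /ss_tau /= /scaled_r addrC addKr. Qed.

Lemma tau_ge0 (R : realType) n (s : chain_state n) : 0 <= tau R s.
Proof. by rewrite tauE divr_ge0. Qed.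

Lemma mean_tau_ge0 (R : realType) n (p lambda : R) k (P : chain_state n -> R) :
  stationary p lambda k P -> 0 <= mean P (@tau R n).
Proof.
move=> [P0 _ _ _].
by apply: sumr_ge0 => s _; rewrite mulr_ge0 // tau_ge0.
Qed.

(** By stationarity the mean potential cancels from the drift inequality, which leaves a bound on
    [n] times the mean of tau. *)
Lemma mean_tau_le (R : realType) n (p lambda L : R) k (P : chain_state n -> R) :
  0 <= p -> p <= 1 -> 0 <= lambda -> (0 < k)%N -> (k.+1 < n)%N ->
  k%:R <= p * (n%:R - k%:R) -> stationary p lambda k P -> 0 < L ->
  mean P (@tau R n) <= (2 * L)^-1 + lambda * (2 + L / 2) / n%:R.
Proof.
case: n P => [//|n'] P p_ge0 p_le1 lambda_ge0 k_gt0 k_lt_n k_small P_stationary L0.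
have n_gt0 : 0 < n'.+1%:R :> R by [].
pose Phi (A : {set 'I_n'.+1}) := potential n'.+1 p L (occ A).
have drift (s : chain_state n'.+1) : admissible p lambda k s.1 ->
    \sum_B kernel p lambda s.1 B * Phi B <=
    (Phi s.1 + (n'.+1%:R / (2 * L) + lambda * (2 + L / 2))) + (- n'.+1%:R) * tau R s.
  move=> /(admissible_good k_lt_n) gs.
  have := step_mean_potential k_lt_n p_ge0 p_le1 lambda_ge0 k_gt0 k_small L0 gs.
  rewrite kernel_mean tauE mulNr mulrCA divff ?gt_eqF // mulr1.
  by move=> /le_trans; apply; rewrite -/(Phi s.1); move: (n'.+1%:R / (2 * L)) => c; lra.
set K := _ / _ + _ in drift.
have := mean_le P_stationary drift.
rewrite -(stationary_mean P_stationary).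
rewrite (meanD P (fun s => Phi s.1 + K)) (meanD P (fun s => Phi s.1)).
rewrite (meanZ P _ (@tau R n'.+1)) (mean_cst P_stationary).
rewrite -addrA lerDl mulNr subr_ge0 mulrC -ler_pdivlMr // mulrDl.
by rewrite mulrAC divff ?gt_eqF // mul1r.
Qed.

Lemma flux_le (R : realType) n (p lambda : R) k (P : chain_state n -> R) :
  0 <= p -> p <= 1 -> 0 <= lambda -> (0 < k)%N -> (k.+1 < n)%N ->
  stationary p lambda k P ->
  `|flux p lambda P - k%:R / n%:R| <= 2 * mean P (@tau R n) + lambda / n%:R.
Proof.
case: n P => [//|n'] P p_ge0 p_le1 lambda_ge0 k_gt0 k_lt_n P_stationary.
have n_gt0 : 0 < n'.+1%:R :> R by [].
have bounds (s : chain_state n'.+1) : admissible p lambda k s.1 ->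
    k%:R / n'.+1%:R + (-2) * tau R s <= flux_at p lambda s.1 <=
    k%:R / n'.+1%:R + lambda / n'.+1%:R.
  move=> adm; have gs := admissible_good k_lt_n adm.
  have := psi_bounds k_lt_n p_ge0 p_le1 lambda_ge0 k_gt0 gs.
  rewrite tauE /flux_at -mulrDl ler_pM2r ?invr_gt0 // => /andP[lo ->].
  by rewrite andbT mulrA -mulrDl ler_pM2r ?invr_gt0 // mulNr.
have lo : k%:R / n'.+1%:R + (-2) * mean P (@tau R n'.+1) <= flux p lambda P.
  rewrite -(meanZ P _ (@tau R n'.+1)) -[X in X + _](mean_cst P_stationary).
  rewrite -(meanD P (fun=> _)).
  by apply: (mean_le P_stationary) => s /bounds/andP[].
have hi : flux p lambda P <= k%:R / n'.+1%:R + lambda / n'.+1%:R.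
  rewrite -[leRHS](mean_cst P_stationary).
  by apply: (mean_le P_stationary) => s /bounds/andP[].
have t0 := mean_tau_ge0 P_stationary.
have ln0 : 0 <= lambda / n'.+1%:R by rewrite divr_ge0.
rewrite ler_norml; move: (k%:R / n'.+1%:R) (lambda / n'.+1%:R) lo hi ln0 => a c.
by move=> *; apply/andP; split; lra.
Qed.

Lemma num_particles_itv (R : realType) (rho : R) n : 0 < rho ->
  rho * n%:R <= (num_particles rho n)%:R < rho * n%:R + 1.
Proof.
move=> rho0; rewrite /num_particles natr_absz ger0_norm; last first.
  by rewrite ceil_ge0 (lt_le_trans (ltrN10 R)) // mulr_ge0 // ltW.
have /andP[+ ->] := ceil_itv (rho * n%:R).
by rewrite intrB ltrBlDr.
Qed.

(** For large [n] the gap between [rho] and [p / (1 + p)] absorbs the rounding of the particle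
    number, which is less than 1. *)
Lemma num_particles_small (R : realType) (p rho : R) n (k := num_particles rho n) :
  0 < rho -> 0 < p -> p <= 1 -> (4 <= n)%N -> 1 + p <= (p - (1 + p) * rho) * n%:R ->
  [/\ (0 < k)%N, (k.+1 < n)%N & k%:R <= p * (n%:R - k%:R)].
Proof.
move=> rho0 p0 p1 n4 n_large; have /andP[lo hi] := num_particles_itv n rho0.
rewrite -/k in lo hi.
have n0 : 0 < n%:R :> R by rewrite ltr0n; exact: leq_trans n4.
have small : k%:R <= p * (n%:R - k%:R).
  have p1' : 0 <= 1 + p by lra.
  by have := ler_wpM2l p1' (ltW hi); move: (k%:R) (n%:R) n_large => x y; lra.
split=> //.
  by rewrite -(ltr0n R) (lt_le_trans _ lo) // mulr_gt0.
have kn : (k <= n)%N.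
  rewrite -(ler_nat R) -subr_ge0 -(pmulr_rge0 _ p0).
  exact: le_trans (ler0n R k) small.
(* As [p <= 1], at most half of the sites are occupied; with [n >= 4] this leaves at least two
   holes. *)
have kn2 : (2 * k <= n)%N.
  rewrite -(ler_nat R) natrM; move: kn; rewrite -(ler_nat R) => kn.
  have : 0 <= (1 - p) * (n%:R - k%:R) by rewrite mulr_ge0 // subr_ge0.
  by move: (k%:R) (n%:R) small => x y; lra.
lia.
Qed.

Section Limits.
Variables (R : realType) (p lambda rho : R).
Variable pi : forall n : nat, chain_state n -> R.
Arguments pi : clear implicits.
Hypotheses (p_gt0 : 0 < p) (p_le1 : p <= 1) (lambda_gt0 : 0 < lambda).
Hypotheses (rho_gt0 : 0 < rho) (rho_lt_h : rho < p / (1 + p)).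
Hypothesis pi_stationary : \forall n \near \oo,
  stationary p lambda (num_particles rho n) (pi n).

Let good_size n := let k := num_particles rho n in
  [/\ (0 < k)%N, (k.+1 < n)%N & k%:R <= p * (n%:R - k%:R)].

Lemma num_particles_near : \forall n \near \oo, good_size n.
Proof.
have gap : 0 < p - (1 + p) * rho.
  by rewrite subr_gt0 mulrC -ltr_pdivlMr // addr_gt0.
near=> n; apply: num_particles_small => //.
  by near: n; exact: nbhs_infty_ge.
rewrite mulrC -ler_pdivrMr //; apply: ltW.
by near: n; exact: nbhs_infty_gtr.
Unshelve. all: by end_near.
Qed.

Lemma tau_near (e : R) : 0 < e -> \forall n \near \oo,
  0 <= mean (pi n) (@tau R n) <= e.
Proof.
move=> e0; have p0 := ltW p_gt0; have l0 := ltW lambda_gt0.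
(* This choice turns [(2 * L)^-1] into [e / 2]; with [L] fixed, the perturbation term falls below
   [e / 2] as [n] grows. *)
pose L := e^-1; have L0 : 0 < L by rewrite invr_gt0.
have K0 : 0 <= lambda * (2 + L / 2) by rewrite mulr_ge0 // addr_ge0 // divr_ge0 // ltW.
near=> n.
have n_large : lambda * (2 + L / 2) / (e / 2) < n%:R by near: n; exact: nbhs_infty_gtr.
have st : stationary p lambda (num_particles rho n) (pi n) by near: n.
have [k0 kn small] : good_size n by near: n; exact: num_particles_near.
have n0 : 0 < n%:R :> R by rewrite ltr0n; apply: leq_trans kn.
rewrite (mean_tau_ge0 st) /=.
have := mean_tau_le p0 p_le1 l0 k0 kn small st L0 => /le_trans; apply.
have e2 : 0 < e / 2 by rewrite divr_gt0.
have -> : (2 * L)^-1 = e / 2 by rewrite invfM invrK mulrC.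
rewrite [leRHS](splitr e) lerD2l ler_pdivrMr // [leRHS]mulrC -ler_pdivrMr //.
exact: ltW.
Unshelve. all: by end_near.
Qed.

Lemma mean_tau_cvg0 : (fun n => mean (pi n) (@tau R n)) @ \oo --> (0 : R).
Proof.
apply/cvgrPdist_le => e e0; near=> n.
have /andP[t0 te] : 0 <= mean (pi n) (@tau R n) <= e by near: n; exact: tau_near.
by rewrite sub0r normrN ger0_norm.
Unshelve. all: by end_near.
Qed.

Lemma mean_continuous_tau_cvg (g : R -> R) : bounded_continuous g ->
  (fun n => mean (pi n) (fun s => g (tau R s))) @ \oo --> g 0.
Proof.
move=> [cg [c gc]]; apply/cvgrPdist_le => e e0.
have e2 : 0 < e / 2 by rewrite divr_gt0.
have /cvgrPdist_le/(_ _ e2)/nbhs_ballP[d /= d0 gd] := cg 0.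
have c0 : 0 <= c by apply: le_trans (gc 0).
(* Continuity handles [t < d]; for [t >= d] the bound [2 * c] is at most [2 * c / d * t], as in
   Markov's inequality. *)
have gbound t : 0 <= t -> `|g t - g 0| <= e / 2 + 2 * c / d * t.
  move=> t0; case: (ltP t d) => td.
    apply: le_trans (_ : e / 2 <= _).
      by rewrite distrC; apply: gd; rewrite /ball /= sub0r normrN ger0_norm.
    by rewrite lerDl mulr_ge0 // divr_ge0 ?mulr_ge0 // ltW.
  apply: le_trans (_ : 2 * c <= _).
    apply: le_trans (ler_normB _ _) _.
    by have := gc t; have := gc 0; lra.
  rewrite -[leLHS]add0r lerD ?(ltW e2) // mulrAC ler_pdivlMr //.
  by rewrite ler_wpM2l ?mulr_ge0.
(* The summand 1 keeps [K] positive even when [c = 0]. *)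
pose K := 2 * c / d + 1.
have K0 : 0 < K by rewrite ltr_wpDl // divr_ge0 ?mulr_ge0 // ltW.
near=> n.
have /andP[t0 te] : 0 <= mean (pi n) (@tau R n) <= e / 2 / K.
  by near: n; apply: tau_near; rewrite divr_gt0.
have st : stationary p lambda (num_particles rho n) (pi n) by near: n.
have [P0 P1 _ _] := st.
rewrite -[g 0](mean_cst st) /mean -sumrB.
apply: le_trans (ler_norm_sum _ _ _) _.
apply: (@le_trans _ _ (mean (pi n) (fun s => e / 2 + 2 * c / d * tau R s))).
  apply: ler_sum => s _; rewrite -mulrBr normrM ger0_norm // ler_wpM2l //.
  by rewrite distrC gbound // tau_ge0.
rewrite (meanD _ (fun=> _)) (mean_cst st) (meanZ _ _ (@tau R n)).
rewrite [leRHS](splitr e) lerD2l.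
apply: le_trans (_ : K * mean (pi n) (@tau R n) <= _).
  by rewrite ler_wpM2r // lerDl.
by rewrite mulrC -ler_pdivlMr.
Unshelve. all: by end_near.
Qed.

Lemma flux_cvg : (fun n => flux p lambda (pi n)) @ \oo --> rho.
Proof.
apply/cvgrPdist_le => e e0; have p0 := ltW p_gt0; have l0 := ltW lambda_gt0.
near=> n.
have n_large : (1 + lambda) / (e / 2) < n%:R by near: n; exact: nbhs_infty_gtr.
have /andP[t0 te] : 0 <= mean (pi n) (@tau R n) <= e / 4.
  by near: n; apply: tau_near; rewrite divr_gt0.
have st : stationary p lambda (num_particles rho n) (pi n) by near: n.
have [k0 kn small] : good_size n by near: n; exact: num_particles_near.
have n0 : 0 < n%:R :> R by rewrite ltr0n; apply: leq_trans kn.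
have := flux_le p0 p_le1 l0 k0 kn st.
have /andP[lo hi] := num_particles_itv n rho_gt0.
have dens : `|rho - (num_particles rho n)%:R / n%:R| <= 1 / n%:R.
  rewrite ler_pdivlMr // -{2}[n%:R](ger0_norm (ltW n0)) -normrM.
  rewrite mulrBl divfK ?gt_eqF // distrC ger0_norm ?subr_ge0 //.
  by rewrite lerBlDl ltW.
move=> dflux; apply: le_trans (ler_distD ((num_particles rho n)%:R / n%:R) _ _) _.
apply: le_trans (lerD dens _) _; first by rewrite distrC; exact: dflux.
rewrite addrCA -mulrDl [leRHS](splitr e); apply: lerD.
  by rewrite mulrC -ler_pdivlMr // -mulrA -invfM -natrM.
by rewrite ler_pdivrMr // [leRHS]mulrC -ler_pdivrMr ?divr_gt0 // ltW.
Unshelve. all: by end_near.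
Qed.

End Limits.

(** * Continuity of tau and almost sure vanishing under a weak limit *)

Section WeakLimit.
Variable R : realType.

Local Notation Borel := (g_sigma_algebraType (@open (scaled_state R))).

(** The functions are arbitrary; where no supremum exists, [sup] has the default value 0. *)
Lemma sup_dist_ge0 (f f' : R -> R) : 0 <= sup_dist f f'.
Proof.
rewrite /sup_dist; set D := [set _ | _ in _].
have [D_sup|D_nosup] := pselect (has_sup D); last by rewrite sup_out.
apply: le_trans (normr_ge0 (f 0 - f' 0)) _; apply: ub_le_sup; first exact: D_sup.2.
by exists 0; rewrite //= in_itv /= lexx ler01.
Qed.

Lemma tau_dist (s t : scaled_state R) : `|ss_tau s - ss_tau t| <= mdist s t.
Proof.
rewrite /mdist /= /ss_dist; have := sup_dist_ge0 (ss_f s) (ss_f t).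
have := circle_dist_ge0 (ss_l s) (ss_l t).
have := circle_dist_ge0 (ss_r s) (ss_r t); lra.
Qed.

Lemma continuous_ss_tau : continuous (@ss_tau R).
Proof.
move=> s; apply/(@cvgrPdist_le _ _ _ (nbhs s) _ (@ss_tau R)) => e e0; near=> t.
apply: le_trans (tau_dist _ _) _; apply: ltW.
have : ball s e t by near: t; exact: nbhsx_ballx.
by rewrite ballEmdist.
Unshelve. all: by end_near.
Qed.

Lemma measurable_continuous (g : Borel -> R) :
  continuous (g : scaled_state R -> R) -> measurable_fun setT g.
Proof.
move=> /continuousP cg; apply: (measurability _ (RGenOpens.measurableE R)).
move=> _ [_ [a [b ->] <-]]; rewrite setTI; apply: sub_sigma_algebra.
exact/cg/interval_open.
Qed.

Lemma probability_zero_set (mu : probability Borel R) (g : Borel -> R) :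
  continuous (g : scaled_state R -> R) -> (forall z, 0 <= g z) ->
  (\int[mu]_x (g x)%:E = 0)%E -> mu [set z | g z = 0] = 1%E.
Proof.
move=> cg g0 intg; have mg := measurable_continuous cg.
have /measurable_EFinP mE := mg.
have mz : measurable [set z | g z = 0].
  by have := mg measurableT _ (measurable_set1 0); rewrite setTI.
have : (\int[mu]_x `|(EFin \o g) x| = 0)%E.
  by rewrite -intg; apply: eq_integral => x _; rewrite /= ger0_norm.
move=> /(ae_eq_integral_abs mu measurableT mE) ae0.
have neg : mu.-negligible (~` [set z | g z = 0]).
  apply: negligibleS ae0 => z /= gz h; apply: gz.
  by have := h I; case.
have mzC : measurable (~` [set z | g z = 0]) by exact: measurableC.
have mu0 : mu (~` [set z | g z = 0]) = 0%E by exact/negligibleP.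
by have := probability_setC mu mzC; rewrite setCK mu0 sube0.
Qed.

End WeakLimit.

Theorem theorem9 (R : realType) (p lambda rho : R)
    (pi : forall n : nat, chain_state n -> R)
    (p_gt0 : 0 < p) (p_le1 : p <= 1) (lambda_gt0 : 0 < lambda)
    (rho_gt0 : 0 < rho) (rho_lt_h : rho < p / (1 + p))
    (pi_stationary : \forall n \near \oo,
       stationary p lambda (num_particles rho n) (pi n)) :
  [/\ (* subsequential weak limits are concentrated on tau = 0 *)
      forall (u : nat -> nat)
        (mu : probability
                (g_sigma_algebraType (@open (scaled_state R))) R),
        {homo u : j k / (j < k)%N} ->
        weak_limit
          (fun k g => mean (pi (u k)) (fun s => g (descriptors R s))) mu ->
        mu [set z | ss_tau z = 0] = 1%E,
      (* tau^n(oo) converges to 0 in distribution *)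
      forall g : R -> R, bounded_continuous g ->
        (fun n => mean (pi n) (fun s => g (ss_tau (descriptors R s)))) @ \oo
          --> g 0,
      (* E tau^n(oo) --> 0 *)
      (fun n => mean (pi n) (fun s => ss_tau (descriptors R s))) @ \oo
        --> (0 : R)
    & (* the limiting flux *)
      (fun n => flux p lambda (pi n)) @ \oo --> rho].
Proof.
split.
- move=> u mu u_homo mu_lim.
  have le_u k : (k <= u k)%N.
    by elim: k => // k IH; apply: leq_ltn_trans IH (u_homo _ _ (ltnSn k)).
  have u_cvg : u @ \oo --> \oo.
    move=> A [N _ NA]; exists N => // k /= Nk.
    by apply: NA; exact: leq_trans Nk (le_u k).
  (* A bounded continuous test function that vanishes only at 0: composed with tau, its integral
     under [mu] is the limit of its means, which is 0. *)
  pose h (t : R) := Num.min `|t| 1.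
  have h0 t : 0 <= h t by rewrite le_min normr_ge0 ler01.
  have h_eq0 t : h t = 0 -> t = 0.
    rewrite /h minEle; case: ifP => _; first exact: normr0_eq0.
    by move/eqP; rewrite oner_eq0.
  have bh : bounded_continuous h.
    split; last by exists 1 => t; rewrite ger0_norm // ge_min lexx orbT.
    by move=> t; apply: continuous_min; [exact: norm_continuous | exact: cst_continuous].
  pose g (z : scaled_state R) := h (ss_tau z).
  have cg : continuous g.
    by move=> z; apply: (@continuous_comp _ _ _ (@ss_tau R) h);
      [exact: continuous_ss_tau | exact: bh.1].
  have bg : bounded_continuous g.
    by split=> //; have [_ [c hc]] := bh; exists c => z; exact: hc.
  have hh0 : h 0 = 0 by rewrite /h normr0 min_l.
  have g_cvg : (fun n => mean (pi n) (fun s => g (descriptors R s))) @ \oo --> (0 : R).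
    rewrite -[X in _ --> X]hh0.
    exact: (mean_continuous_tau_cvg p_gt0 p_le1 lambda_gt0 rho_gt0 rho_lt_h
      pi_stationary bh).
  have int_g : (\int[mu]_x (g x)%:E = 0)%E.
    apply: (cvg_unique _ (mu_lim g bg)) => //.
    apply/fine_cvgP; split; first by near=> k.
    exact: cvg_comp u_cvg g_cvg.
  rewrite -(probability_zero_set cg (fun z => h0 _) int_g); congr (mu _).
  by apply/seteqP; split=> z /=; [move=> zt; rewrite /g zt | exact: h_eq0].
- move=> g; exact: (mean_continuous_tau_cvg p_gt0 p_le1 lambda_gt0 rho_gt0 rho_lt_h
    pi_stationary).
- exact: (mean_tau_cvg0 p_gt0 p_le1 lambda_gt0 rho_gt0 rho_lt_h
    pi_stationary).
- exact: (flux_cvg p_gt0 p_le1 lambda_gt0 rho_gt0 rho_lt_h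
    pi_stationary).
Unshelve. all: by end_near.
Qed.
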